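(* Let $G=(V,E)$ be a connected, locally finite, quasi-transitive graph with exponential growth, and let $p_c=p_c(G)$ be its critical probability for Bernoulli bond percolation. Then \[\kappa_{p_c}(n):=\inf\left\{\tau_{p_c}(x,y) : x,y\in V,\ d(x,y)\leq n\right\}\leq \mathrm{gr}(G)^{-n}\] for all integers $n\geq 1$.
   Context: All graphs $G=(V,E)$ are connected and locally finite; $d$ denotes graph distance. In Bernoulli bond percolation with parameter $p\in[0,1]$, each edge of $G$ is independently retained with probability $p$ and deleted otherwise; the resulting random graph (with vertex set $V$) is denoted $G[p]$, and its connected components are called clusters. The critical probability is $p_c(G)=\sup\{p\in[0,1] : G[p] \text{ has no infinite clusters almost surely}\}$. For $x,y\in V$, $\tau_p(x,y)$ is the probability that $x$ and $y$ are connected in $G[p]$ (i.e. lie in the same cluster). The graph $G$ is quasi-transitive if the action of its automorphism group $\mathrm{Aut}(G)$ on $V$ has only finitely many orbits. Write $B(x,r)$ for the graph-distance ball of radius $r$ about $x\in V$, i.e. the set of vertices at graph distance at most $r$ from $x$. Define $\mathrm{gr}(G):=\liminf_{r\to\infty}|B(x,r)|^{1/r}$, where $x$ is a vertex of $G$; this does not depend on the choice of $x$. The graph $G$ has exponential growth if $\mathrm{gr}(G)>1$. *)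

(* Defs.v *)
From HB Require Import structures.
From mathcomp Require Import all_boot all_order all_algebra.
From mathcomp Require Import finmap.
From mathcomp Require Import all_classical all_reals all_analysis.
From mathcomp Require Import ring lra.

Set Implicit Arguments.
Unset Strict Implicit.
Unset Printing Implicit Defensive.

Import Order.TTheory GRing.Theory Num.Theory.
Import numFieldNormedType.Exports.

Local Open Scope classical_set_scope.
Local Open Scope ring_scope.

(** * Bernoulli product measures on [E -> bool], for an arbitrary index type *)

Definition coordinate_events (E : Type) : set (set (E -> bool)) :=
  range (fun e => [set w : E -> bool | w e]).

(* [E -> bool] with the product sigma-algebra *)
Notation configuration E := (g_sigma_algebraType (@coordinate_events E)).

(* The coordinates are independent and each of them is [true] with
   probability [p]: [P] has the product values on finite cylinders. *)
Definition is_bernoulli_product (R : realType) (E : choiceType) (p : R)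
    (P : probability (configuration E) R) : Prop :=
  forall (s : seq E) (b : E -> bool), uniq s ->
    P [set w : E -> bool | {in s, w =1 b}] =
    (\prod_(e <- s) (if b e then p else 1 - p))%:E.

Section cylinders.
Variable E : choiceType.
Implicit Types (w : E -> bool) (s t : seq E) (A B : set (E -> bool)).

Definition depends_on s A : Prop :=
  forall w w', {in s, w =1 w'} -> A w -> A w'.

Definition cylinder A : Prop := exists s, depends_on s A.

Lemma depends_onE s A w w' : depends_on s A -> {in s, w =1 w'} -> A w = A w'.
Proof.
by move=> sA ww'; apply/propext; split; apply: sA => // e /ww'.
Qed.

Lemma cylinder0 : cylinder set0.
Proof. by exists [::]. Qed.

Lemma cylinderC A : cylinder A -> cylinder (~` A).
Proof.
by case=> s sA; exists s => w w' ww' + ; rewrite /setC /= (depends_onE sA ww').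
Qed.

Lemma cylinderU A B : cylinder A -> cylinder B -> cylinder (A `|` B).
Proof.
case=> s sA [t tB]; exists (s ++ t) => w w' ww' [Aw|Bw]; [left|right].
- by apply: sA Aw => e es; apply: ww'; rewrite mem_cat es.
- by apply: tB Bw => e et; apply: ww'; rewrite mem_cat et orbT.
Qed.

Definition cylinder_space : Type := {ptws E -> bool}.

HB.instance Definition _ := Pointed.on cylinder_space.
HB.instance Definition _ := Topological.copy cylinder_space {ptws E -> bool}.
HB.instance Definition _ := @isAlgebraOfSets.Build default_measure_display
  cylinder_space cylinder cylinder0 cylinderU cylinderC.

Lemma cylinder_open (A : set cylinder_space) : cylinder A -> open A.
Proof.
move=> [s sA]; rewrite openE => w Aw; rewrite /interior.
suff h t : nbhs w [set w' : E -> bool | {in t, w =1 w'}].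
  by apply: filterS (h s) => w' sww'; exact: sA Aw.
elim: t => [|e t IH]; first by apply: filterS (@filterT _ _ _).
have he : nbhs w [set w' : E -> bool | w' e = w e].
  exact: (@proj_continuous E (fun _ => bool) e w [set w e]
    (discrete_set1 (w e))).
apply: filterS2 he IH => w' /= we wt i; rewrite inE => /orP[/eqP ->//|].
exact: wt.
Qed.

(* By compactness, a cylinder is not a countable union of infinitely many
   disjoint nonempty cylinders. *)
Lemma cylinder_bigcup (F : (set cylinder_space)^nat) :
  (forall i, cylinder (F i)) -> trivIset setT F ->
  cylinder (\bigcup_i F i) -> exists N, forall n, (N <= n)%N -> F n = set0.
Proof.
move=> cF tF cU.
have cT : compact [set: cylinder_space].
  have := @tychonoff _ (fun _ : E => _) _ (fun=> bool_compact).
  by congr (compact _); rewrite eqEsubset.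
have : compact (\bigcup_i F i).
  apply: subclosed_compact cT _ => //.
  rewrite -[X in closed X]setCK; apply: open_closedC.
  by apply: cylinder_open; exact: cylinderC.
rewrite compact_cover => /(_ nat setT F) [].
- by move=> i _; exact: cylinder_open.
- by [].
move=> D _ UD; exists (\max_(i <- D) i).+1 => n nD.
apply/seteqP; split=> // w Fnw.
have [i iD Fiw] : exists2 i, i \in D & F i w by apply: UD; exists n.
have ni : n = i by apply: (tF n i) => //; exists w.
by move: nD; rewrite ni ltnNge leq_bigmax_seq.
Qed.

End cylinders.

Section bernoulli_product_existence.
Variables (R : realType) (E : choiceType) (p : R).
Implicit Types (w : E -> bool) (s t : seq E) (f g : (E -> bool) -> R)
  (A B : set (E -> bool)).

Let upd w e b : E -> bool := fun e' => if e' == e then b else w e'.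

(* integration of the coordinate [e] *)
Let avg e f w : R := p * f (upd w e true) + (1 - p) * f (upd w e false).

Let avgs s f := foldr avg f s.

Let supp s f := forall w w', {in s, w =1 w'} -> f w = f w'.

Let updC w e b e' b' : e != e' ->
  upd (upd w e b) e' b' = upd (upd w e' b') e b.
Proof.
move=> ee'; apply/funext => i; rewrite /upd.
by case: (eqVneq i e') => // ->; rewrite eq_sym (negbTE ee').
Qed.

Let avgC e e' f : avg e (avg e' f) = avg e' (avg e f).
Proof.
apply/funext => w; have [->//|ee'] := eqVneq e e'.
by rewrite /avg !(@updC w e _ e')//; ring.
Qed.

Let avg_avgs e s f : avg e (avgs s f) = avgs s (avg e f).
Proof. by elim: s => //= e' s <-; rewrite avgC. Qed.

Let avgsC s t f : avgs s (avgs t f) = avgs t (avgs s f).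
Proof. by elim: s => //= e s ->; rewrite avg_avgs. Qed.

Let supp_avg e s f : supp (e :: s) f -> supp s (avg e f).
Proof.
move=> sf w w' ww'; rewrite /avg; congr (_ * _ + _ * _); apply: sf => i;
  by rewrite inE /upd; case: eqP => //= _ /ww'.
Qed.

Let supp_avgs s f : supp s f -> supp [::] (avgs s f).
Proof.
elim: s f => //= e s IH f sf.
by rewrite avg_avgs; apply: IH; exact: supp_avg.
Qed.

Let avgs_cst s f : supp [::] f -> avgs s f = f.
Proof.
move=> sf; elim: s => //= e s ->; apply/funext => w; rewrite /avg.
by rewrite (sf (upd w e true) w)// (sf (upd w e false) w)//; ring.
Qed.

Let avgs_uniq s t f : supp s f -> supp t f -> avgs s f = avgs t f.
Proof.
move=> sf tf; rewrite -(avgs_cst t (supp_avgs sf)) avgsC.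
by rewrite avgs_cst//; exact: supp_avgs.
Qed.

Let avgsD s f g w : avgs s (f \+ g) w = avgs s f w + avgs s g w.
Proof. by elim: s w => //= e s IH w; rewrite /avg !IH; ring. Qed.

Let avgsZ s k f w : avgs s (fun w => k * f w) w = k * avgs s f w.
Proof. by elim: s w => //= e s IH w; rewrite /avg !IH; ring. Qed.

Let ind A w : R := (w \in A)%:R.

Let supp_ind s A : depends_on s A -> supp s (ind A).
Proof. by move=> sA w w' ww'; congr (nat_of_bool (asbool _))%:R; exact: depends_onE sA ww'. Qed.

Let mass A : R :=
  if pselect (cylinder A) is left h then avgs (sval (cid h)) (ind A) point else 0.

Let massE s A w : depends_on s A -> mass A = avgs s (ind A) w.
Proof.
move=> sA; rewrite /mass; case: pselect => [h|[]]; last by exists s.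
case: cid => t tA /=; rewrite (avgs_uniq (supp_ind tA) (supp_ind sA)).
exact: (supp_avgs (supp_ind sA)).
Qed.

Let mass0 : mass set0 = 0.
Proof. by rewrite (@massE [::] _ point)//= /ind in_set0. Qed.

Let massT : mass setT = 1.
Proof. by rewrite (@massE [::] _ point)//= /ind in_setT. Qed.

Let massU A B : cylinder A -> cylinder B -> A `&` B = set0 ->
  mass (A `|` B) = mass A + mass B.
Proof.
move=> [s sA] [t tB] AB0.
have -> : mass A = avgs (s ++ t) (ind A) point.
  apply: massE => w w' ww'; apply: sA => e es.
  by apply: ww'; rewrite mem_cat es.
have -> : mass B = avgs (s ++ t) (ind B) point.
  apply: massE => w w' ww'; apply: tB => e et.
  by apply: ww'; rewrite mem_cat et orbT.
rewrite -avgsD (_ : ind A \+ ind B = ind (A `|` B)).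
  apply: massE => w w' ww' [Aw|Bw]; [left|right].
  - by apply: sA Aw => e es; apply: ww'; rewrite mem_cat es.
  - by apply: tB Bw => e et; apply: ww'; rewrite mem_cat et orbT.
apply/funext => w; rewrite /= /ind in_setU.
case: (boolP (w \in A)) => /=; last by rewrite add0r.
rewrite inE => Aw; case: (boolP (w \in B)); last by rewrite addr0.
by rewrite inE => Bw; suff : set0 w by []; rewrite -AB0.
Qed.

Let mass_cylinder s (b : E -> bool) : uniq s ->
  depends_on s [set w : E -> bool | {in s, w =1 b}] /\
  mass [set w : E -> bool | {in s, w =1 b}] =
  \prod_(e <- s) (if b e then p else 1 - p).
Proof.
move=> us; have sA : depends_on s [set w : E -> bool | {in s, w =1 b}].
  by move=> w w' ww' /= h e es; rewrite -ww' ?h.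
split=> //; rewrite (massE point sA); move: (point) => w.
elim: s us w {sA} => [_ w|e s IH /= /andP[es us] w].
  by rewrite big_nil /= /ind mem_set.
rewrite big_cons avg_avgs -(IH us w) -avgsZ.
congr (avgs s _ w); apply/funext => {}w.
have E1 c : ind [set w : E -> bool | {in e :: s, w =1 b}] (upd w e c) =
    (c == b e)%:R * ind [set w : E -> bool | {in s, w =1 b}] w.
  rewrite /ind -natrM mulnb; congr (nat_of_bool _)%:R; apply/idP/idP.
    rewrite !inE /= => h; apply/andP; split.
      by have := h e (mem_head _ _); rewrite /upd eqxx => ->.
    rewrite inE /= => i si; rewrite -h ?inE ?si ?orbT// /upd.
    by case: eqP => // ie; rewrite -ie si in es.
  case/andP => /eqP cb; rewrite !inE /= => h i; rewrite /upd.
  by case: eqP => [->//|/eqP/negbTE ie]; rewrite inE ie /= => /h.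
by rewrite /avg !E1; case: (b e); rewrite /= ?eqxx /=; ring.
Qed.

Hypothesis p01 : 0 <= p <= 1.

Let avgs_ge0 s f : (forall w, 0 <= f w) -> forall w, 0 <= avgs s f w.
Proof.
case/andP: p01 => p0 p1 f0; elim: s => //= e s IH w.
by rewrite addr_ge0// mulr_ge0// subr_ge0.
Qed.

Let cmass (A : set (cylinder_space E)) : \bar R := (mass A)%:E.

Let cmass0 : cmass set0 = 0%E. Proof. by rewrite /cmass mass0. Qed.

Let cmass_ge0 A : (0 <= cmass A)%E.
Proof.
rewrite lee_fin /mass; case: pselect => // h.
by apply: avgs_ge0 => w; rewrite /ind ler0n.
Qed.

Let cmass_sigma_additive : semi_sigma_additive cmass.
Proof.
move=> F mF tF mUF; have [N FN] := cylinder_bigcup mF tF mUF.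
have mU n : cylinder (\big[setU/set0]_(0 <= i < n) F i).
  by elim/big_ind : _ => [||i _]; [exact: cylinder0|exact: cylinderU|exact: mF].
have sumE n : (\sum_(0 <= i < n) cmass (F i))%E =
    cmass (\big[setU/set0]_(0 <= i < n) F i).
  elim: n => [|n IH]; first by rewrite !big_geq.
  rewrite !big_nat_recr//= IH -EFinD /cmass massU//; first exact: mF.
  rewrite big_mkord; apply/eqP/negPn/negP => /set0P[w [+ Fnw]].
  rewrite -bigcup_mkord => -[i /= ni Fiw].
  by have /(tF i n Logic.I Logic.I) ii : F i `&` F n !=set0; [exists w|
    rewrite ii ltnn in ni].
have UE n : (N <= n)%N -> \big[setU/set0]_(0 <= i < n) F i = \bigcup_i F i.
  move=> Nn; rewrite big_mkord -bigcup_mkord; apply/seteqP; split.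
    by move=> w [i _ Fiw]; exists i.
  move=> w [i _ Fiw]; exists i => //=; rewrite ltnNge; apply/negP => ni.
  by move: Fiw; rewrite FN// (leq_trans Nn).
apply: cvg_near_cst; near=> n; rewrite sumE UE//; near: n.
by exists N.
Unshelve. all: by end_near. Qed.

Let mu : {measure set (cylinder_space E) -> \bar R} :=
  HB.pack cmass (isMeasure.Build _ _ _ cmass
    cmass0 cmass_ge0 cmass_sigma_additive).

Let ext : set (configuration E) -> \bar R := measure_extension mu.

Let ext0 : ext set0 = 0%E. Proof. exact: measure0. Qed.

Let ext_ge0 A : (0 <= ext A)%E. Proof. exact: measure_ge0. Qed.

Let coordinate_cylinder :
  <<s @coordinate_events E >> `<=` <<s @cylinder E >>.
Proof.
apply: smallest_sub; first exact: smallest_sigma_algebra.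
move=> _ [e _ <-]; apply: sub_sigma_algebra; exists [:: e] => w w' ww' /=.
by rewrite (ww' e)// mem_head.
Qed.

Let ext_sigma_additive : semi_sigma_additive ext.
Proof.
move=> F mF tF mUF.
apply: (@measure_semi_sigma_additive _ _ _ (measure_extension mu)) => //.
  by move=> i; apply: coordinate_cylinder; exact: mF.
by apply: coordinate_cylinder; exact: mUF.
Qed.

Let extT : ext setT = 1%E.
Proof.
rewrite /ext /measure_extension measurable_mu_extE /= /cmass ?massT//.
Qed.

Let ext_measure : {measure set (configuration E) -> \bar R} :=
  HB.pack ext (isMeasure.Build _ _ _ ext ext0 ext_ge0 ext_sigma_additive).

Let ext_probability : probability (configuration E) R :=
  HB.pack (Measure.sort ext_measure)
    (Measure_isProbability.Build _ _ _ (Measure.sort ext_measure) extT).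

Lemma bernoulli_product_exists :
  exists P : probability (configuration E) R, is_bernoulli_product p P.
Proof.
exists ext_probability => s b us; have [sA mA] := mass_cylinder b us.
rewrite /= /ext /measure_extension measurable_mu_extE /= /cmass ?mA//.
by exists s.
Qed.

End bernoulli_product_existence.

(* For [p] outside [0, 1] there is no such law and the value is a dummy. *)
Definition bernoulli_product (R : realType) (E : choiceType) (p : R) :
    probability (configuration E) R :=
  xget (\d_(point : configuration E) : probability (configuration E) R)
    [set P | is_bernoulli_product p P].

Lemma bernoulli_productP (R : realType) (E : choiceType) (p : R) :
  0 <= p <= 1 -> is_bernoulli_product p (bernoulli_product E p).
Proof.
by move=> p01; have /(xgetPex point) := bernoulli_product_exists E p01.
Qed.

(** * Graphs: a graph is a symmetric irreflexive relation [G] on [V] *)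

Section graphs.
Variables (V : choiceType) (G : rel V).

Definition walk (n : nat) (x y : V) : Prop :=
  exists s : seq V, [/\ path G x s, last x s = y & size s = n].

Definition joined (x y : V) : Prop := exists n, walk n x y.

Definition graph_connected : Prop := forall x y, joined x y.

Definition locally_finite : Prop := forall x, finite_set [set y | G x y].

Definition automorphism (f : V -> V) : Prop :=
  bijective f /\ {mono f : x y / G x y}.

Definition aut_orbit (x : V) : set V :=
  [set y | exists2 f, automorphism f & f x = y].

Definition quasi_transitive : Prop := finite_set (range aut_orbit).

(* The dummy value 0 is used only when [x] and [y] are not joined. *)
Definition graph_dist (x y : V) : nat :=
  if pselect (exists n, `[< walk n x y >]) is left h then ex_minn h else 0.

Definition graph_ball (x : V) (r : nat) : set V :=
  [set y | (graph_dist x y <= r)%N].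

Definition growth (R : realType) (x : V) : \bar R :=
  limn_einf (fun r : nat =>
    ((#|` fset_set (graph_ball x r)|%:R : R) `^ (r%:R^-1))%:E).

Definition edges : set (set V) :=
  [set e | exists x y, G x y /\ e = [set x; y]].

End graphs.

(** * Bernoulli bond percolation *)

Section percolation.
Variables (R : realType) (V : choiceType) (G : rel V).

(* the random subgraph encoded by [w], with [w e] iff the edge [e] is retained *)
Definition retained (w : configuration (edges G)) : rel V :=
  fun x y => `[< exists e : edges G, val e = [set x; y] /\ w e >].

Definition percolation (p : R) : probability (configuration (edges G)) R :=
  bernoulli_product (edges G) p.

Definition cluster_at (w : configuration (edges G)) (x : V) : set V :=
  [set y | joined (retained w) x y].

Definition no_infinite_cluster (w : configuration (edges G)) : Prop :=
  forall x, finite_set (cluster_at w x).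

Definition critical_probability : R :=
  sup [set p | 0 <= p <= 1 /\
    {ae percolation p, forall w, no_infinite_cluster w}].

Definition tau (p : R) (x y : V) : \bar R :=
  percolation p [set w | joined (retained w) x y].

Definition kappa (p : R) (n : nat) : \bar R :=
  ereal_inf [set t | exists x y, (graph_dist G x y <= n)%N /\ t = tau p x y].

End percolation.

(* Main.v *)
Require Import Defs.
From mathcomp Require Import all_boot all_order all_algebra.
From mathcomp Require Import finmap.
From mathcomp Require Import all_classical all_reals all_analysis.
From mathcomp Require Import ring lra.

Set Implicit Arguments.
Unset Strict Implicit.
Unset Printing Implicit Defensive.

Import Order.TTheory GRing.Theory Num.Theory.
Import numFieldNormedType.Exports.

Local Open Scope classical_set_scope.
Local Open Scope ring_scope.

(** Write kappa for the infimum of the connection probabilities over pairs at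
distance at most n.  By the Harris inequality, splitting a geodesic into m pieces
of length at most n shows that any two points at distance at most m n are
connected with probability at least kappa ^ m.  If moreover the expected size of
clusters is bounded by a constant C, summing over a ball gives
#|B(x, m n)| * kappa ^ m <= C for all m, and m-th roots yield
gr(G) ^ n <= 1 / kappa [limn_einf_root_le, le_inv_growth].

At the critical probability the expected cluster size is infinite in general, so
the bound is first proved for p < p_c and then passed to the limit: every
connection probability is increasing in p and is the supremum over finite boxes
of polynomials in p, hence left continuous; as there are only finitely many
orbits of pairs at distance at most n, the infimum kappa is left continuous too
[tauR_left_continuous_unif].  When p_c = 0 no such p exists, but then the clusters
at p = p_c are single points and the bound applies to p_c itself.

What remains is the sharpness of the phase transition: bounded expected cluster
size for every p < p_c.  The argument is that of Duminil-Copin and Tassion.  For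
a finite set S containing u, let phi_p(S, u) be the expected number of open edges
from the part of S connected to u inside S to the complement of S.

- If every vertex u has some S with phi_p(S, u) < 1, the Simon--Lieb inequality
  [simon_lieb] bounds the susceptibility in any finite box by
  #|S| + phi_p(S, u) times its supremum, whence a bound that does not depend on
  the box; quasi-transitivity makes the sets S uniform
  [susceptibility_bounded, susceptibility_finite].
- If some vertex o has phi_p(S, o) >= 1 for all S, Russo's formula gives
  f' >= 1 - f on [p, 1] for the probability f that o is connected to the outside
  of a box [differential_inequality], so that at every q > p this probability is
  bounded below independently of the box [exit_prob_lower]; then o lies in an
  infinite cluster with positive probability at q, and p >= p_c.

All probabilistic inequalities are proved for functions of finitely many edges,
whose expectation is an iterated average over a list of edges; there the Harris
inequality, Russo's formula and independence are short inductions.  The infinite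
product measure enters only through its values on cylinders and through monotone
limits along balls. *)

(** * Expectations of functions of finitely many edges *)

Section finite_expectation.
Variables (R : realType) (E : eqType).
Implicit Types (w : E -> bool) (e : E) (s : seq E) (T : set E).
Implicit Types (f g : (E -> bool) -> R) (p : R).

Definition upd w e b : E -> bool := fun i => if i == e then b else w i.

(** Only the coordinates in [s] are averaged, the others are frozen at [w]; this
dependence on [w] is what makes induction on [s] go through. *)
Fixpoint expect p s f w : R :=
  if s is e :: s' then
    p * expect p s' f (upd w e true) + (1 - p) * expect p s' f (upd w e false)
  else f w.

Definition supported T f :=
  forall w w', (forall e, T e -> w e = w' e) -> f w = f w'.

Definition increasing f :=
  forall w w', (forall e, w e -> w' e) -> f w <= f w'.

Definition influence e f w : R := f (upd w e true) - f (upd w e false).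

Lemma upd_upd w e b c : upd (upd w e b) e c = upd w e c.
Proof. by apply/funext => i; rewrite /upd; case: eqP. Qed.

Lemma updC w e b e' b' : e != e' ->
  upd (upd w e b) e' b' = upd (upd w e' b') e b.
Proof.
move=> ee'; apply/funext => i; rewrite /upd.
by case: (eqVneq i e') => // ->; rewrite eq_sym (negbTE ee').
Qed.

Lemma upd_id w e : upd w e (w e) = w.
Proof. by apply/funext => i; rewrite /upd; case: eqP => // ->. Qed.

Lemma le_upd w w' e b : (forall i, w i -> w' i) ->
  forall i, upd w e b i -> upd w' e b i.
Proof. by move=> ww' i; rewrite /upd; case: eqP => // _; exact: ww'. Qed.

Lemma eq_expect p s f g w : f =1 g -> expect p s f w = expect p s g w.
Proof. by move=> fg; elim: s w => //= e s IH w; rewrite !IH. Qed.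

Lemma expectD p s f g w :
  expect p s (fun w => f w + g w) w = expect p s f w + expect p s g w.
Proof. by elim: s w => //= e s IH w; rewrite !IH; ring. Qed.

Lemma expectZ p s k f w : expect p s (fun w => k * f w) w = k * expect p s f w.
Proof. by elim: s w => //= e s IH w; rewrite !IH; ring. Qed.

Lemma expect_cst p s k w : expect p s (fun=> k) w = k.
Proof. by elim: s w => //= e s IH w; rewrite !IH; ring. Qed.

Lemma expect_sum p s (I : Type) (r : seq I) (P : pred I)
    (F : I -> (E -> bool) -> R) w :
  expect p s (fun w => \sum_(i <- r | P i) F i w) w =
  \sum_(i <- r | P i) expect p s (F i) w.
Proof.
elim: r => [|i r IH].
  rewrite big_nil -[RHS](expect_cst p s 0 w).
  by apply: eq_expect => ?; rewrite big_nil.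
rewrite big_cons -IH; case: ifP => Pi.
  rewrite -expectD; apply: eq_expect => ?.
  by rewrite big_cons Pi.
by apply: eq_expect => ?; rewrite big_cons Pi.
Qed.

Lemma le_expect p s f g w : 0 <= p <= 1 -> (forall w, f w <= g w) ->
  expect p s f w <= expect p s g w.
Proof.
move=> /andP[p0 p1] fg; elim: s w => //= e s IH w.
by rewrite lerD// ler_wpM2l// subr_ge0.
Qed.

Lemma expect_ge0 p s f w : 0 <= p <= 1 -> (forall w, 0 <= f w) -> 0 <= expect p s f w.
Proof. by move=> p01 f0; rewrite -(expect_cst p s 0 w); exact: le_expect. Qed.

Lemma supported_expect T p s f : supported T f -> supported T (expect p s f).
Proof.
move=> Tf; elim: s => //= e s IH w w' ww'; congr (_ * _ + _ * _); apply: IH => i;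
  by rewrite /upd; case: eqP => // _; exact: ww'.
Qed.

Lemma sub_supported T T' f : T `<=` T' -> supported T f -> supported T' f.
Proof. by move=> TT' Tf w w' ww'; apply: Tf => e /TT'; exact: ww'. Qed.

Lemma supported_upd T f w e b : supported T f -> ~ T e -> f (upd w e b) = f w.
Proof. by move=> Tf Te; apply: Tf => i Ti; rewrite /upd; case: eqP => // ie; subst. Qed.

(** Averaging one coordinate acts on only one of the two factors, and leaves the
supports unchanged. *)
Lemma expect_indep T p s f g w : supported T f -> supported (~` T) g ->
  expect p s (fun w => f w * g w) w = expect p s f w * expect p s g w.
Proof.
move=> Tf Tg; elim: s w => //= e s IH w; rewrite !IH.
have [Te|Te] := pselect (T e).
- rewrite !(supported_upd _ _ (supported_expect p s Tg)); try by apply.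
  by ring.
- rewrite !(supported_upd _ _ (supported_expect p s Tf))//; ring.
Qed.

Lemma increasing_expect p s f : 0 <= p <= 1 -> increasing f ->
  increasing (expect p s f).
Proof.
move=> /andP[p0 p1] incf; elim: s => //= e s IH w w' ww'.
by rewrite lerD// ler_wpM2l ?subr_ge0//; apply: IH; exact: le_upd.
Qed.

Lemma increasing_upd f w e : increasing f -> f (upd w e false) <= f (upd w e true).
Proof. by move=> incf; apply: incf => i; rewrite /upd; case: eqP. Qed.

(** Averaging a coordinate preserves monotonicity, so the inequality reduces to
the case of a single two-valued coordinate. *)
Lemma Harris_inequality p s f g w : 0 <= p <= 1 -> increasing f -> increasing g ->
  expect p s f w * expect p s g w <= expect p s (fun w => f w * g w) w.
Proof.
move=> p01 incf incg; elim: s w => //= e s IH w.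
have [p0 p1] := andP p01.
set f1 := expect p s f (upd w e true); set f0 := expect p s f (upd w e false).
set g1 := expect p s g (upd w e true); set g0 := expect p s g (upd w e false).
apply: (@le_trans _ _ (p * (f1 * g1) + (1 - p) * (f0 * g0))); last first.
  by apply: lerD; apply: ler_wpM2l; rewrite ?subr_ge0//; exact: IH.
have f01 : 0 <= f1 - f0 by rewrite subr_ge0 increasing_upd//; exact: increasing_expect.
have g01 : 0 <= g1 - g0 by rewrite subr_ge0 increasing_upd//; exact: increasing_expect.
(* Chebyshev's sum inequality for two atoms *)
rewrite -subr_ge0 [leRHS](_ : _ = p * (1 - p) * ((f1 - f0) * (g1 - g0))); last by ring.
by rewrite !mulr_ge0// subr_ge0.
Qed.

Lemma le_expect_p p q s f w : 0 <= p -> p <= q -> q <= 1 -> increasing f ->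
  expect p s f w <= expect q s f w.
Proof.
move=> p0 pq q1 incf; elim: s w => //= e s IH w.
have q01 : 0 <= q <= 1 by rewrite q1 (le_trans p0).
have := increasing_upd w e (increasing_expect s q01 incf).
move: (IH (upd w e true)) (IH (upd w e false)).
set b1 := expect q s f _; set b0 := expect q s f (upd w e false).
set a1 := expect p s f _; set a0 := expect p s f (upd w e false) => h1 h0 b01.
rewrite -subr_ge0
  [leRHS](_ : _ = (q - p) * (b1 - b0) + p * (b1 - a1) + (1 - p) * (b0 - a0)).
  by rewrite !addr_ge0// mulr_ge0// subr_ge0//; apply: le_trans q1.
by ring.
Qed.

Lemma expect_influence p s f w e : e \notin s ->
  expect p s (influence e f) w = influence e (expect p s f) w.
Proof.
rewrite /influence; elim: s w => //= i s IH w.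
rewrite inE negb_or => /andP[ei es].
by rewrite !IH// !(updC _ _ _ ei); ring.
Qed.

Lemma influence_upd e f w b : influence e f (upd w e b) = influence e f w.
Proof. by rewrite /influence !upd_upd. Qed.

(** The expectation is affine in the parameter of each single edge, with slope the
influence of that edge; all parameters being equal to [p], the chain rule adds
these slopes. *)
Lemma Russo_formula s f w p : uniq s ->
  is_derive p 1 (fun p : R => expect p s f w)
    (\sum_(e <- s) expect p s (influence e f) w).
Proof.
elim: s w => [|e s IH] w /=.
  by move=> _; rewrite big_nil; exact: is_derive_cst.
case/andP => es us.
have h1 := IH (upd w e true) us; have h0 := IH (upd w e false) us.
apply: is_derive_eq.
rewrite /GRing.scale /= !big_cons !expect_influence// !influence_upd.
by rewrite big_split /= -!big_distrr /= /influence; ring.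
Qed.

End finite_expectation.

(** This yields the invariance of connection probabilities under automorphisms of the
graph by a finite computation, instead of a uniqueness theorem for the product
measure. *)
Lemma expect_map (R : realType) (E F : eqType) (h : E -> F) (p : R) s f
    (w : F -> bool) : injective h ->
  expect p (map h s) (fun w => f (w \o h)) w = expect p s f (w \o h).
Proof.
move=> hinj; elim: s w => //= e s IH w; rewrite !IH.
suff E1 b : upd w (h e) b \o h = upd (w \o h) e b by rewrite !E1.
by apply/funext => i; rewrite /= /upd inj_eq.
Qed.

(** * Cylinders under the Bernoulli product measure *)

Section product_measure.
Variables (R : realType) (E : choiceType) (p : R).
Variable P : probability (configuration E) R.
Hypothesis Pp : is_bernoulli_product p P.
Implicit Types (s t : seq E) (A : set (E -> bool)) (b w : E -> bool).

Definition ind (A : set (E -> bool)) w : R := (w \in A)%:R.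

Lemma measurable_agree t b :
  measurable ([set w : E -> bool | {in t, w =1 b}] : set (configuration E)).
Proof.
elim: t => [|e t IH].
  by rewrite (_ : mkset _ = setT)//; apply/seteqP; split.
have me : measurable ([set w : E -> bool | w e = b e] : set (configuration E)).
  have m1 : measurable ([set w : E -> bool | w e] : set (configuration E)).
    by apply: sub_sigma_algebra; exists e.
  case: (b e) => //.
  rewrite (_ : mkset _ = ~` [set w : E -> bool | w e]); first exact: measurableC.
  by apply/seteqP; split=> w /=; case: (w e).
rewrite (_ : mkset _ = [set w : E -> bool | w e = b e] `&`
                       [set w : E -> bool | {in t, w =1 b}]).
  exact: measurableI.
apply/seteqP; split => w /=.
  by move=> h; split=> [|i it]; apply: h; rewrite inE ?eqxx// it orbT.
by move=> [h1 h2] i; rewrite inE => /orP[/eqP->//|]; exact: h2.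
Qed.

(** The coordinates in [t] have been revealed and equal [b], those in [s] remain to
be averaged; revealing one more coordinate splits the event in two. *)
Lemma measure_agreeI s t A b : uniq (s ++ t) -> depends_on (s ++ t) A ->
  measurable (A `&` [set w : E -> bool | {in t, w =1 b}] : set (configuration E)) /\
  P (A `&` [set w : E -> bool | {in t, w =1 b}]) =
  ((\prod_(e <- t) (if b e then p else 1 - p)) * expect p s (ind A) b)%:E.
Proof.
elim: s t b => [|e s IH] t b /=.
  move=> ut tA; rewrite /ind; have [bA|bA] := boolP (b \in A).
    rewrite (_ : _ `&` _ = [set w : E -> bool | {in t, w =1 b}]).
      by split; [exact: measurable_agree | rewrite Pp// mulr1].
    apply/seteqP; split=> w /=; first by case.
    move=> wb; split=> //; move: bA; rewrite inE; apply: tA => i it.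
    by rewrite wb.
  rewrite (_ : _ `&` _ = set0); first by split => //; rewrite measure0 mulr0.
  apply/seteqP; split=> w //= -[Aw wb]; move/negP: bA; apply; rewrite inE.
  exact: tA Aw.
case/andP => es ust etA.
have ust' : uniq (s ++ e :: t).
  by rewrite -(cat1s e t) uniq_catCA cat1s /= es.
have etA' : depends_on (s ++ e :: t) A.
  move=> w w' ww'; apply: etA => i ii; apply: ww'.
  by move: ii; rewrite inE !mem_cat inE orbCA.
have et : e \notin t by move: es; rewrite mem_cat negb_or => /andP[].
have [m1 P1] := IH (e :: t) (upd b e true) ust' etA'.
have [m0 P0] := IH (e :: t) (upd b e false) ust' etA'.
have prodE c : \prod_(i <- e :: t) (if upd b e c i then p else 1 - p) =
    (if c then p else 1 - p) * \prod_(i <- t) (if b i then p else 1 - p).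
  rewrite big_cons /upd eqxx; congr (_ * _); apply: eq_big_seq => i it.
  by case: eqP => // ie; move: et; rewrite -ie it.
have -> : A `&` [set w : E -> bool | {in t, w =1 b}] =
  (A `&` [set w : E -> bool | {in e :: t, w =1 upd b e true}]) `|`
  (A `&` [set w : E -> bool | {in e :: t, w =1 upd b e false}]).
  rewrite -setIUr; congr (_ `&` _); apply/seteqP; split=> w /=.
    move=> wb; have : {in e :: t, w =1 upd b e (w e)}.
      move=> i; rewrite /upd inE; case: eqP => [->//|_] /=; exact: wb.
    by case: (w e) => ?; [left|right].
  have h c : {in e :: t, w =1 upd b e c} -> {in t, w =1 b}.
    move=> wb i it; rewrite wb ?inE ?it ?orbT// /upd.
    by case: eqP => // ie; move: et; rewrite -ie it.
  by case; exact: h.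
split; first exact: measurableU.
rewrite measureU//.
  apply: (etrans (congr2 (fun x y => x + y)%E P1 P0)).
  by rewrite -EFinD !prodE; congr _%:E; ring.
apply/seteqP; split => w //= [[_ h1] [_ h2]].
by have := h1 e (mem_head _ _); rewrite h2 ?mem_head// /upd eqxx.
Qed.

Lemma measurable_depends s A : depends_on s A ->
  measurable (A : set (configuration E)).
Proof.
move=> sA; have [||+ _] := @measure_agreeI (undup s) [::] A point.
- by rewrite cats0 undup_uniq.
- by move=> w w' ww'; apply: sA => e es; apply: ww'; rewrite cats0 mem_undup.
by rewrite (_ : mkset _ = setT) ?setIT//; apply/seteqP; split.
Qed.

Lemma measure_depends s A w : uniq s -> depends_on s A ->
  P A = (expect p s (ind A) w)%:E.
Proof.
move=> us sA; have [||_ +] := @measure_agreeI s [::] A w; rewrite ?cats0//.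
rewrite (_ : mkset _ = setT) ?setIT ?big_nil ?mul1r//.
by apply/seteqP; split.
Qed.

End product_measure.

(** * Walks, balls and edges *)

Local Open Scope fset_scope.
Local Open Scope ring_scope.

Section joined.
Variable V : choiceType.
Implicit Types (e : rel V) (x y z : V).

Lemma joinedxx e x : joined e x x.
Proof. by exists 0%N, [::]. Qed.

Lemma joined_cons e y x z : e x y -> joined e y z -> joined e x z.
Proof. by move=> xy [n [s [p l sz]]]; exists n.+1, (y :: s); rewrite /= xy sz. Qed.

Lemma joined1 e x y : e x y -> joined e x y.
Proof. by move=> xy; exact: joined_cons xy (joinedxx _ _). Qed.

(** Induction on a walk read backwards from its fixed endpoint [z]. *)
Lemma joined_ind e z (Q : V -> Prop) : Q z ->
  (forall x y, e x y -> joined e y z -> Q y -> Q x) ->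
  forall x, joined e x z -> Q x.
Proof.
move=> Qz IH x [n [s []]].
elim: s x n => [x n _ /= -> //|y s IHs x n /= /andP[xy ps] l _].
apply: (IH x y xy); first by exists (size s), s.
exact: IHs ps l erefl.
Qed.

Lemma joined_trans e y x z : joined e x y -> joined e y z -> joined e x z.
Proof.
move=> + yz; move: x; apply: joined_ind => // a b ab _; exact: joined_cons.
Qed.

Lemma joined_sym e x y : symmetric e -> joined e x y -> joined e y x.
Proof.
move=> es; move: x; apply: joined_ind => [|a b ab _ yb]; first exact: joinedxx.
by apply: (joined_trans yb); apply: joined1; rewrite es.
Qed.

Lemma sub_joined e e' x y : (forall a b, e a b -> e' a b) ->
  joined e x y -> joined e' x y.
Proof.
move=> ee'; move: x; apply: joined_ind => [|a b /ee' ab _]; first exact: joinedxx.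
exact: joined_cons.
Qed.

Definition within (A : {fset V}) e : rel V :=
  fun a b => [&& a \in A, b \in A & e a b].

(** A walk along [leaving A e] visits [A] except possibly at its last vertex. *)
Definition leaving (A : {fset V}) e : rel V := fun a b => (a \in A) && e a b.

Lemma within_sym A e : symmetric e -> symmetric (within A e).
Proof. by move=> es x y; rewrite /within es andbCA. Qed.

Lemma sub_within A A' e e' x y : {subset A <= A'} ->
  (forall a b, e a b -> e' a b) ->
  joined (within A e) x y -> joined (within A' e') x y.
Proof.
move=> AA' ee'; apply: sub_joined => a b /and3P[aA bA ab].
by rewrite /within !AA'//= ee'.
Qed.

End joined.

Section graph.
Variables (V : choiceType) (G : rel V).
Hypothesis G_sym : symmetric G.
Hypothesis G_conn : graph_connected G.
Hypothesis G_lf : locally_finite G.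
Implicit Types (x y z : V) (A : {fset V}).

Definition nbrs x : {fset V} := fset_set [set y | G x y].

Lemma in_nbrs x y : (y \in nbrs x) = G x y.
Proof. by rewrite in_fset_set; [apply/idP/idP => [/set_mem|/mem_set]|exact: G_lf]. Qed.

Lemma graph_distP x y n :
  (graph_dist G x y <= n)%N <-> exists2 m, (m <= n)%N & walk G m x y.
Proof.
rewrite /graph_dist; case: pselect => [h|[]]; last first.
  by have [m xy] := G_conn x y; exists m; apply/asboolP.
case: ex_minnP => m /asboolP wm minm; split; first by exists m.
by case=> k kn wk; apply: leq_trans kn; apply: minm; apply/asboolP.
Qed.

Lemma walkS n x y : walk G n.+1 x y -> exists2 z, G x z & walk G n z y.
Proof.
by case=> s []; case: s => [|z s] //= /andP[xz ps] l [sz]; exists z => //; exists s.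
Qed.

Lemma finite_walk n x : finite_set [set y | walk G n x y].
Proof.
elim: n x => [|n IH] x.
  apply: (@sub_finite_set _ _ [set x]); last exact: finite_set1.
  by move=> y [s []]; case: s => //= _ ->.
apply: (@sub_finite_set _ _
  (\bigcup_(z in [set z | G x z]) [set y | walk G n z y])).
  by move=> y /= /walkS[z xz zy]; exists z.
exact: bigcup_finite.
Qed.

Lemma finite_graph_ball x n : finite_set (graph_ball G x n).
Proof.
apply: (@sub_finite_set _ _
  (\bigcup_(m in `I_n.+1) [set y | walk G m x y])).
  by move=> y /graph_distP[m mn xy]; exists m.
by apply: bigcup_finite => // m _; exact: finite_walk.
Qed.

Definition fball x n : {fset V} := fset_set (graph_ball G x n).

Lemma in_fball x y n : (y \in fball x n) = (graph_dist G x y <= n)%N.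
Proof.
rewrite in_fset_set; last exact: finite_graph_ball.
by apply/idP/idP => [/set_mem|h]//; exact: mem_set.
Qed.

Lemma sub_fball x m n : (m <= n)%N -> {subset fball x m <= fball x n}.
Proof. by move=> mn y; rewrite !in_fball => /leq_trans; apply. Qed.

(** A walk is finite, hence connectivity is a monotone union of events that depend
on finitely many edges. *)
Lemma joined_fball o e x y : joined e x y ->
  exists n, joined (within (fball o n) e) x y.
Proof.
move: x; apply: joined_ind => [|a b ab _ [n bn]]; first by exists 0%N; exact: joinedxx.
pose N := maxn n (maxn (graph_dist G o a) (graph_dist G o b)).
have sub : {subset fball o n <= fball o N} by apply: sub_fball; rewrite leq_maxl.
exists N.
apply: (@joined_cons _ _ b); last exact: sub_within bn.
by rewrite /within !in_fball !leq_max !leqnn !orbT.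
Qed.

Lemma graph_dist_split m n x y : (graph_dist G x y <= m + n)%N ->
  exists z, (graph_dist G x z <= m)%N /\ (graph_dist G z y <= n)%N.
Proof.
move=> /graph_distP[k kmn [s [ps ls sz]]].
exists (last x (take m s)); split; apply/graph_distP.
  exists (size (take m s)); first by rewrite size_take; case: ltnP.
  exists (take m s); split=> //; move: ps.
  by rewrite -{1}(cat_take_drop m s) cat_path => /andP[].
exists (size (drop m s)); first by rewrite size_drop sz leq_subLR.
exists (drop m s); move: ps ls; rewrite -{1 2}(cat_take_drop m s) cat_path last_cat.
by move=> /andP[_ ->].
Qed.

Local Notation E := (edges G).
Implicit Types (w : E -> bool).

Lemma edgeP (e : E) : exists x y, G x y /\ val e = [set x; y]%classic.
Proof. exact: (set_mem (valP e)). Qed.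

Definition edges_at A : seq E :=
  undup (pmap insub [seq [set x; y]%classic | x <- A, y <- nbrs x]).

Lemma edges_at_uniq A : uniq (edges_at A).
Proof. exact: undup_uniq. Qed.

Lemma mem_edges_at A (e : E) x : x \in A -> (val e : set V) x -> e \in edges_at A.
Proof.
move=> xA ex; rewrite mem_undup mem_pmap_sub.
have [a [b [ab eab]]] := edgeP e; rewrite eab in ex *.
apply/allpairsPdep; case: ex => /= xE; subst.
  by exists a, b; rewrite in_nbrs.
by exists b, a; rewrite in_nbrs G_sym setUC.
Qed.

Lemma edge_of x y : G x y -> exists e : E, val e = [set x; y]%classic.
Proof.
move=> xy; have h : [set x; y]%classic \in E by rewrite inE; exists x, y.
by exists (SigSub h).
Qed.

Lemma retained_sym w : symmetric (retained w).
Proof. by move=> x y; apply/asboolP/asboolP => -[e]; rewrite setUC; exists e. Qed.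

Lemma retained_agree w w' x y :
  (forall e : E, val e = [set x; y]%classic -> w e = w' e) ->
  retained w x y -> retained w' x y.
Proof.
by move=> ww' /asboolP[e [exy we]]; apply/asboolP; exists e; rewrite -ww'.
Qed.

Lemma retained_mono w w' x y : (forall e, w e -> w' e) ->
  retained w x y -> retained w' x y.
Proof. by move=> ww' /asboolP[e [? /ww' ?]]; apply/asboolP; exists e. Qed.

Lemma set2_inj x y a b : [set x; y]%classic = [set a; b]%classic ->
  (x = a /\ y = b) \/ (x = b /\ y = a).
Proof.
move=> h; have : [set a; b]%classic x by rewrite -h; left.
have : [set a; b]%classic y by rewrite -h; right.
have : [set x; y]%classic a by rewrite h; left.
have : [set x; y]%classic b by rewrite h; right.
by rewrite /=; do 4 (case=> ?); subst; auto.
Qed.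

Lemma retained_adj w x y : retained w x y -> G x y.
Proof.
move=> /asboolP[e [exy _]]; have [a [b [ab]]] := edgeP e.
by rewrite exy => /set2_inj[[-> ->]//|[-> ->]]; rewrite G_sym.
Qed.

Lemma retainedE w (e : E) x y : val e = [set x; y]%classic -> retained w x y = w e.
Proof.
move=> exy; apply/asboolP/idP => [[e' [e'xy we']]|we]; last by exists e.
by have -> : e = e' by apply: val_inj; rewrite exy.
Qed.

End graph.

(** * Connection probabilities in finite sets *)

Lemma joined_map (V W : choiceType) (e : rel V) (e' : rel W) (h : V -> W) x y :
  (forall a b, e a b -> e' (h a) (h b)) -> joined e x y -> joined e' (h x) (h y).
Proof.
move=> ee'; move: x; apply: joined_ind => [|a b /ee' ab _]; first exact: joinedxx.
exact: joined_cons.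
Qed.

Section indicators.
Variables (R : realType) (E : choiceType).
Implicit Types (w : E -> bool) (A B : set (E -> bool)) (T : set E) (s : seq E).

Lemma ind_ge0 A w : 0 <= ind R A w.
Proof. exact: ler0n. Qed.

Lemma ind_le1 A w : ind R A w <= 1.
Proof. by rewrite /ind; case: (_ \in _). Qed.

Lemma indT A w : A w -> ind R A w = 1.
Proof. by move=> Aw; rewrite /ind mem_set. Qed.

Lemma indF A w : ~ A w -> ind R A w = 0.
Proof. by move=> Aw; rewrite /ind memNset. Qed.

Lemma le_ind A B w : (A w -> B w) -> ind R A w <= ind R B w.
Proof.
move=> AB; have [Aw|Aw] := pselect (A w); last by rewrite indF ?ind_ge0.
by rewrite !indT//; exact: AB.
Qed.

Lemma supported_ind T A :
  (forall w w', (forall e, T e -> w e = w' e) -> A w -> A w') ->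
  supported T (ind R A).
Proof.
move=> TA w w' ww'; apply/le_anti/andP; split; apply: le_ind; apply: TA => //.
by move=> e /ww'.
Qed.

Lemma supported_depends s T A : (forall e, T e -> e \in s) ->
  (forall w w', (forall e, T e -> w e = w' e) -> A w -> A w') ->
  depends_on s A.
Proof. by move=> Ts TA w w' ww'; apply: TA => e /Ts; exact: ww'. Qed.

Lemma increasing_ind A : (forall w w', (forall e, w e -> w' e) -> A w -> A w') ->
  increasing (ind R A).
Proof. by move=> incA w w' ww'; apply: le_ind; exact: incA. Qed.

(** Both sides are the measure of [A] under the infinite product. *)
Lemma expect_depends (p : R) s s' A w w' : 0 <= p <= 1 -> uniq s -> uniq s' ->
  depends_on s A -> depends_on s' A ->
  expect p s (ind R A) w = expect p s' (ind R A) w'.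
Proof.
move=> p01 us us' sA s'A; apply: EFin_inj.
have h := measure_depends (@bernoulli_productP R E p p01).
by rewrite -(h s _ w us sA) -(h s' _ w' us' s'A).
Qed.

Lemma expect_ind_le1 (p : R) s A w : 0 <= p <= 1 -> expect p s (ind R A) w <= 1.
Proof.
by move=> p01; rewrite -(expect_cst p s 1 w); apply: le_expect => // ?; exact: ind_le1.
Qed.

End indicators.

Section connection.
Variables (R : realType) (V : choiceType) (G : rel V).
Hypothesis G_sym : symmetric G.
Hypothesis G_lf : locally_finite G.
Local Notation E := (edges G).
Implicit Types (x y z : V) (A : {fset V}) (w : E -> bool) (p : R).

Definition conn A x y : set (E -> bool) :=
  [set w | joined (within A (retained w)) x y].

Definition inside A : set E := [set e : E | forall x, (val e : set V) x -> x \in A].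

Lemma conn_inside A x y w w' : (forall e, inside A e -> w e = w' e) ->
  conn A x y w -> conn A x y w'.
Proof.
move=> ww'; apply: sub_joined => a b /and3P[aA bA ab].
rewrite /within aA bA /=; apply: retained_agree ab => e eab; apply: ww' => z.
by rewrite eab => -[|] /= ->.
Qed.

Lemma conn_mono A x y w w' : (forall e, w e -> w' e) ->
  conn A x y w -> conn A x y w'.
Proof. move=> ww'; apply: sub_within => // a b; exact: retained_mono. Qed.

Lemma sub_conn A A' x y w : {subset A <= A'} -> conn A x y w -> conn A' x y w.
Proof. by move=> AA'; exact: sub_within. Qed.

Lemma conn_sym A x y w : conn A x y w -> conn A y x w.
Proof. apply: joined_sym; apply: within_sym; exact: retained_sym. Qed.

Lemma conn_depends A s x y : {subset edges_at G A <= s} ->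
  depends_on s (conn A x y).
Proof.
move=> sA; apply: (@supported_depends _ _ (inside A)); last exact: conn_inside.
move=> e Ae; apply: sA; have [a [b [ab eab]]] := edgeP e.
by apply: (@mem_edges_at _ _ G_sym G_lf _ _ a); rewrite ?Ae// eab; left.
Qed.

Definition conn_prob p A x y : R :=
  expect p (edges_at G A) (ind R (conn A x y)) (fun=> false).

Lemma expect_conn p A s x y w : 0 <= p <= 1 -> uniq s -> {subset edges_at G A <= s} ->
  expect p s (ind R (conn A x y)) w = conn_prob p A x y.
Proof.
move=> p01 us sA; apply: expect_depends => //; first exact: edges_at_uniq.
- exact: conn_depends.
- exact: conn_depends.
Qed.

Lemma conn_prob_ge0 p A x y : 0 <= p <= 1 -> 0 <= conn_prob p A x y.
Proof. by move=> p01; apply: expect_ge0 => // ?; exact: ind_ge0. Qed.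

Lemma conn_prob_le1 p A x y : 0 <= p <= 1 -> conn_prob p A x y <= 1.
Proof. exact: expect_ind_le1. Qed.

Lemma sub_edges_at A A' : {subset A <= A'} -> {subset edges_at G A <= edges_at G A'}.
Proof.
move=> AA' e; rewrite mem_undup mem_pmap_sub => /allpairsPdep[a [b [aA ab eab]]].
by apply: (@mem_edges_at _ _ G_sym G_lf _ _ a); [exact: AA'|rewrite eab; left].
Qed.

Lemma le_conn_prob_p p q A x y : 0 <= p -> p <= q -> q <= 1 ->
  conn_prob p A x y <= conn_prob q A x y.
Proof.
move=> p0 pq q1; apply: le_expect_p => //; apply: increasing_ind => w w'.
exact: conn_mono.
Qed.

Lemma le_conn_prob_A p A A' x y : 0 <= p <= 1 -> {subset A <= A'} ->
  conn_prob p A x y <= conn_prob p A' x y.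
Proof.
move=> p01 AA'; rewrite -(@expect_conn p A (edges_at G A') x y (fun=> false))//.
- by apply: le_expect => // w; apply: le_ind; exact: sub_conn.
- exact: edges_at_uniq.
- exact: sub_edges_at.
Qed.

(** The Harris inequality, applied to two increasing events whose intersection
joins [x] to [z] through [y]. *)
Lemma conn_prob_mul p A x y z : 0 <= p <= 1 ->
  conn_prob p A x y * conn_prob p A y z <= conn_prob p A x z.
Proof.
move=> p01; apply: le_trans (Harris_inequality _ _ p01 _ _) _.
- by apply: increasing_ind => w w'; exact: conn_mono.
- by apply: increasing_ind => w w'; exact: conn_mono.
apply: le_expect => // w.
have [xy|xy] := pselect (conn A x y w); last by rewrite indF// mul0r ind_ge0.
by rewrite indT// mul1r; apply: le_ind; exact: joined_trans.
Qed.

Section automorphism.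
Variables (f g : V -> V).
Hypothesis fg : cancel f g.
Hypothesis gf : cancel g f.
Hypothesis f_mono : {mono f : x y / G x y}.

Lemma edge_image_subproof (e : E) : (f @` (val e : set V))%classic \in E.
Proof.
have [a [b [ab ->]]] := edgeP e; rewrite inE; exists (f a), (f b).
rewrite f_mono; split=> //; apply/seteqP; split=> z /=.
  by move=> [t [->|->] <-]; [left|right].
by move=> [->|->]; [exists a => //; left|exists b => //; right].
Qed.

Definition edge_image (e : E) : E := SigSub (edge_image_subproof e).

Lemma edge_image_inj : injective edge_image.
Proof.
move=> e e' /(congr1 val) /= h; apply: val_inj; apply/seteqP; split => z ez.
  have : (f @` (val e' : set V))%classic (f z) by rewrite -h; exists z.
  by move=> [t e't /(can_inj fg) <-].
have : (f @` (val e : set V))%classic (f z) by rewrite h; exists z.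
by move=> [t e't /(can_inj fg) <-].
Qed.

Lemma edge_imageE (e : E) a b : val e = [set a; b]%classic ->
  val (edge_image e) = [set f a; f b]%classic.
Proof.
move=> /= ->; apply/seteqP; split=> z /=.
  by move=> [t [->|->] <-]; [left|right].
by move=> [->|->]; [exists a => //; left|exists b => //; right].
Qed.

Lemma retained_image w x y :
  retained (w \o edge_image) x y = retained w (f x) (f y).
Proof.
apply/idP/idP => [/asboolP[e [exy we]]|h].
  by apply/asboolP; exists (edge_image e); rewrite (edge_imageE exy).
have := retained_adj G_sym h; rewrite f_mono => /edge_of[e exy].
by rewrite (retainedE _ exy) /= -(retainedE w (edge_imageE exy)).
Qed.

Lemma conn_image A x y w :
  conn [fset f z | z in A] (f x) (f y) w <-> conn A x y (w \o edge_image).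
Proof.
split; last first.
  apply: joined_map => a b /and3P[aA bA ab].
  by rewrite /within !in_imfset//= -retained_image.
rewrite -{2}(fg x) -{2}(fg y); apply: joined_map => a b /and3P[].
move=> /imfsetP[/= a' aA ->] /imfsetP[/= b' bA ->].
by rewrite !fg /within aA bA retained_image.
Qed.

Lemma conn_prob_image p A x y : 0 <= p <= 1 ->
  conn_prob p [fset f z | z in A] (f x) (f y) = conn_prob p A x y.
Proof.
move=> p01.
transitivity (expect p (map edge_image (edges_at G A))
  (ind R (conn [fset f z | z in A] (f x) (f y))) (fun=> false)).
  apply: expect_depends => //; first exact: edges_at_uniq.
  - by rewrite map_inj_uniq ?edges_at_uniq//; exact: edge_image_inj.
  - exact: conn_depends.
  - move=> w w' ww' /conn_image wA; apply/conn_image; move: wA.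
    apply: (@conn_depends A (edges_at G A)) => // e eA.
    by apply: ww'; exact: map_f.
transitivity (expect p (map edge_image (edges_at G A))
  (fun w => ind R (conn A x y) (w \o edge_image)) (fun=> false)).
  apply: eq_expect => w; rewrite /ind; congr (nat_of_bool _)%:R.
  by apply/idP/idP; rewrite !inE => /conn_image.
rewrite expect_map//; exact: edge_image_inj.
Qed.

End automorphism.

End connection.

(** * The Simon--Lieb inequality and finite susceptibility *)

Lemma sum_delta (R : pzRingType) (I : eqType) (r : seq I) c (H : I -> R) :
  uniq r -> c \in r -> \sum_(i <- r) (c == i)%:R * H i = H c.
Proof.
move=> ur cr; rewrite (bigD1_seq c)//= eqxx mul1r big1 ?addr0// => i ic.
by rewrite eq_sym (negbTE ic) mul0r.
Qed.

Lemma le_sum_term (R : numDomainType) (I : eqType) (r : seq I) (P : pred I)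
    (F : I -> R) i : i \in r -> P i -> (forall j, 0 <= F j) ->
  F i <= \sum_(j <- r | P j) F j.
Proof.
move=> ir Pi F0; rewrite (big_rem i)//= Pi lerDl.
by rewrite sumr_ge0.
Qed.

Section simon_lieb.
Variables (R : realType) (V : choiceType) (G : rel V).
Hypothesis G_sym : symmetric G.
Hypothesis G_lf : locally_finite G.
Local Notation E := (edges G).
Implicit Types (x y z u v : V) (A S L C : {fset V}) (w : E -> bool) (p : R).

(** [p * boundary_sum p S u] is the quantity phi_p(S, u) of Duminil-Copin and
Tassion: the expected number of open edges joining the cluster of [u] in [S] to
the complement of [S]. *)
Definition boundary_sum p S u : R :=
  \sum_(x <- S) \sum_(y <- nbrs G x | y \notin S) conn_prob G p S x u.

Definition cluster_in S u w : {fset V} := [fset x in S | `[< conn S x u w >]].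

Lemma in_cluster_in S u w x : x \in cluster_in S u w <-> x \in S /\ conn S x u w.
Proof.
by rewrite !inE /=; split=> [/andP[? /asboolP]|[-> ?]] //; apply/asboolP.
Qed.

(** Exploring the cluster of [u] in [S] reveals only the edges of [S] that touch
it. *)
Lemma cluster_in_supported S u C :
  supported [set e : E | inside S e /\ exists2 x, x \in C & (val e : set V) x]
    (fun w => (cluster_in S u w == C)%:R : R).
Proof.
move=> w w' ww'.
suff : cluster_in S u w = C <-> cluster_in S u w' = C.
  by move=> h; congr (nat_of_bool _)%:R; apply/eqP/eqP => /h.
have H w1 w2 :
    (forall e, inside S e /\ (exists2 x, x \in C & (val e : set V) x) -> w1 e = w2 e) ->
    cluster_in S u w1 = C -> cluster_in S u w2 = C.
  move=> h CE.
  have step w3 w4 a b : (forall e, inside S e /\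
      (exists2 x, x \in C & (val e : set V) x) -> w3 e = w4 e) ->
      within S (retained w3) a b -> conn S b u w1 -> within S (retained w4) a b.
    move=> h' /and3P[aS bS ab] bu; rewrite /within aS bS /=.
    apply: retained_agree ab => e eab; apply: h'; split.
      by move=> z; rewrite eab => -[|] ->.
    exists b; last by rewrite eab; right.
    by rewrite -CE; apply/in_cluster_in.
  rewrite -CE; apply/fsetP => x; apply/idP/idP => /in_cluster_in[xS xu];
    apply/in_cluster_in; split=> //; move: x {xS} xu.
    apply: joined_ind; first exact: joinedxx.
    by move=> a b ab _ bu; apply: joined_cons (bu); apply: step ab bu => e /h.
  apply: joined_ind; first exact: joinedxx.
  by move=> a b ab bu; apply: joined_cons; exact: step ab bu.
by split; apply: H => // e /ww'.
Qed.

Lemma expect_edge p s (e : E) w : uniq s -> e \in s ->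
  expect p s (fun w => (w e)%:R) w = p.
Proof.
elim: s w => //= i s IH w /andP[is_ us]; rewrite inE => /orP[/eqP ei|es]; last first.
  by rewrite !IH//; ring.
have h t w' : i \notin t -> expect p t (fun w => (w e)%:R) w' = (w' e)%:R.
  elim: t w' => //= j t IHt w'; rewrite inE negb_or => /andP[ij it].
  rewrite !IHt// /upd ei; case: eqP => [ij'|_]; last by ring.
  by rewrite ij' eqxx in ij.
by rewrite !h// /upd ei eqxx /=; ring.
Qed.

(** Take the last visit of the path to the cluster of [u] in [S].  The next vertex
cannot be in [S], else it would belong to the cluster. *)
Lemma last_exit_cluster L S u v w : u \in S -> v \notin S -> conn L u v w ->
  exists x y, [/\ x \in cluster_in S u w, y \notin S, retained w x y &
    conn (L `\` cluster_in S u w) y v w].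
Proof.
move=> uS vS; set C := cluster_in S u w => uv.
have uC : u \in C by apply/in_cluster_in; split=> //; exact: joinedxx.
suff main x : conn L x v w -> (x \notin C /\ conn (L `\` C) x v w) \/
    exists x y, [/\ x \in C, y \notin S, retained w x y & conn (L `\` C) y v w].
  by have [[]|] := main _ uv; first by rewrite uC.
move: x; apply: joined_ind => [|a b /and3P[aL bL ab] _ [[bC bv]|]]; last by right.
  left; split; last exact: joinedxx.
  by apply/negP => /in_cluster_in[]; rewrite (negbTE vS).
have [aC|aC] := boolP (a \in C).
  right; exists a, b; split=> //; apply/negP => bS; move/negP: bC; apply.
  move: aC => /in_cluster_in[aS au]; apply/in_cluster_in; split=> //.
  apply: joined_cons au; rewrite /within aS bS /=.
  by rewrite retained_sym.
left; split=> //; apply: joined_cons bv.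
by rewrite /within !in_fsetD aL bL aC bC.
Qed.

(** The sum over [C] conditions on the explored cluster: only its value contributes.
The path after [y] avoids [C], so that it uses unexplored edges only. *)
Lemma simon_lieb_pointwise L S u v w : u \in S -> v \notin S ->
  ind R (conn L u v) w <= \sum_(x <- S) \sum_(y <- nbrs G x | y \notin S)
    \sum_(C <- fpowerset S) (cluster_in S u w == C)%:R *
      ((x \in C)%:R * (ind R [set w | retained w x y] w *
         ind R (conn (L `\` C) y v) w)).
Proof.
move=> uS vS; set c := cluster_in S u w.
have cS : c \in fpowerset S.
  by rewrite fpowersetE; apply/fsubsetP => x /in_cluster_in[].
under eq_bigr => x _ do under eq_bigr => y _ do
  rewrite (sum_delta (fun C => (x \in C)%:R * (ind R [set w | retained w x y] w *
         ind R (conn (L `\` C) y v) w)) (fset_uniq _) cS).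
have F0 x y : 0 <= (x \in c)%:R * (ind R [set w | retained w x y] w *
         ind R (conn (L `\` c) y v) w).
  by rewrite !mulr_ge0 ?ind_ge0.
have [uv|uv] := pselect (conn L u v w); last first.
  by rewrite indF//; apply: sumr_ge0 => x _; exact: sumr_ge0.
have [x [y [xc yS xy yv]]] := last_exit_cluster uS vS uv.
rewrite indT//; apply: (@le_trans _ _ (\sum_(y <- nbrs G x | y \notin S)
   (x \in c)%:R * (ind R [set w | retained w x y] w *
         ind R (conn (L `\` c) y v) w))); last first.
  have := le_sum_term (F := fun x => \sum_(y <- nbrs G x | y \notin S)
   (x \in c)%:R * (ind R [set w | retained w x y] w *
         ind R (conn (L `\` c) y v) w)) (P := xpredT) (r := S) (i := x).
  apply => //; first by have /in_cluster_in[] := xc.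
  by move=> ?; exact: sumr_ge0.
have := le_sum_term (F := fun y => (x \in c)%:R * (ind R [set w | retained w x y] w *
         ind R (conn (L `\` c) y v) w)) (P := fun y => y \notin S)
         (r := nbrs G x) (i := y).
move=> /(_ _ yS (F0 _)); rewrite in_nbrs// => /(_ (retained_adj G_sym xy)).
by rewrite xc !indT// !mul1r.
Qed.

Lemma conn_supported A x y :
  supported (inside A) (ind R (conn A x y) : (E -> bool) -> R).
Proof. by apply: supported_ind; exact: conn_inside. Qed.

Lemma retained_supported x y : supported [set e : E | val e = [set x; y]%classic]
  (ind R [set w : E -> bool | retained w x y]).
Proof. by apply: supported_ind => w w' ww'; exact: retained_agree. Qed.

(** Given that the explored cluster is [C], the edge from [x] to [y] and the
connection from [y] to [v] off [C] are independent of the exploration and of each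
other. *)
Lemma simon_lieb_term p L S u v x y C s w0 : 0 <= p <= 1 -> uniq s ->
  {subset edges_at G L <= s} -> {subset edges_at G S <= s} ->
  x \in S -> y \notin S -> G x y ->
  expect p s (fun w => (cluster_in S u w == C)%:R *
      ((x \in C)%:R * (ind R [set w | retained w x y] w *
         ind R (conn (L `\` C) y v) w))) w0 <=
  expect p s (fun w => (cluster_in S u w == C)%:R * (x \in C)%:R) w0 *
    (p * conn_prob G p L y v).
Proof.
move=> p01 us Ls Ss xS yS xy.
have [e exy] := edge_of xy.
have P0 : 0 <= p * conn_prob G p L y v.
  by rewrite mulr_ge0 ?conn_prob_ge0//; case/andP: p01.
have [xC|xC] := boolP (x \in C); last first.
  rewrite (_ : expect _ _ _ _ = 0); last first.
    rewrite -[RHS](expect_cst p s 0 w0); apply: eq_expect => w.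
    by rewrite mul0r mulr0.
  by rewrite mulr_ge0// expect_ge0// => w; rewrite mulr_ge0.
rewrite (@expect_indep _ _ _ p s (fun w => (cluster_in S u w == C)%:R)
  (fun w => true%:R * (ind R [set w | retained w x y] w *
     ind R (conn (L `\` C) y v) w)) w0 (@cluster_in_supported S u C)); last first.
  move=> w w' ww'; congr (_ * (_ * _)).
    apply: retained_supported => e' /= e'xy; apply: ww' => -[h _].
    by move/negP: yS; apply; apply: h; rewrite /= e'xy; right.
  apply: conn_supported => e' he'.
  apply: ww' => -[_ [z zC e'z]].
  by have := he' z e'z; rewrite in_fsetD zC.
apply: ler_pM => //.
- by apply: expect_ge0.
- by apply: expect_ge0 => // w; rewrite !mulr_ge0 ?ind_ge0.
- by apply: le_expect => // w; rewrite mulr1.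
rewrite (@eq_expect _ _ _ _ _ (fun w => ind R [set w | retained w x y] w *
  ind R (conn (L `\` C) y v) w)); last by move=> w; rewrite mul1r.
rewrite (expect_indep _ _ _ (@retained_supported x y)); last first.
  apply: (sub_supported _ (@conn_supported (L `\` C) y v)) => e' he' /= e'xy.
  by have := he' x; rewrite /= e'xy in_fsetD xC => /(_ (or_introl erefl)).
apply: ler_pM.
- by apply: expect_ge0 => // ?; exact: ind_ge0.
- by apply: expect_ge0 => // ?; exact: ind_ge0.
- rewrite (@eq_expect _ _ _ _ _ (fun w => (w e)%:R)) ?expect_edge//.
    by apply: Ss; apply: (@mem_edges_at _ _ G_sym G_lf _ _ x) => //; rewrite exy; left.
  move=> w; rewrite /ind -(retainedE w exy); congr (nat_of_bool _)%:R.
  by apply/idP/idP; rewrite inE.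
- rewrite -(expect_conn G_sym G_lf y v w0 p01 us Ls).
  apply: le_expect => // w; apply: le_ind; apply: sub_conn => z.
  by rewrite in_fsetD => /andP[].
Qed.

Lemma simon_lieb p L S u v : 0 <= p <= 1 -> u \in S -> v \notin S ->
  conn_prob G p L u v <= \sum_(x <- S) \sum_(y <- nbrs G x | y \notin S)
    p * conn_prob G p S x u * conn_prob G p L y v.
Proof.
move=> p01 uS vS; pose s := edges_at G (L `|` S); pose w0 : E -> bool := fun=> false.
have us : uniq s by exact: edges_at_uniq.
have Ls : {subset edges_at G L <= s}.
  by apply: sub_edges_at => // z; rewrite in_fsetU => ->.
have Ss : {subset edges_at G S <= s}.
  by apply: sub_edges_at => // z; rewrite in_fsetU orbC => ->.
rewrite -(expect_conn G_sym G_lf u v w0 p01 us Ls).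
apply: (le_trans (le_expect _ _ p01 (fun w => simon_lieb_pointwise L w uS vS))).
rewrite expect_sum big_seq [leRHS]big_seq; apply: ler_sum => x xS.
rewrite expect_sum big_seq_cond [leRHS]big_seq_cond; apply: ler_sum => y /andP[yx yS].
rewrite expect_sum.
have xy : G x y by rewrite -in_nbrs.
apply: le_trans (ler_sum _ (fun C _ =>
  @simon_lieb_term p L S u v x y C s w0 p01 us Ls Ss xS yS xy)) _.
rewrite -mulr_suml -expect_sum (@eq_expect _ _ _ _ _ (ind R (conn S x u))); last first.
  move=> w; rewrite (sum_delta (fun C => (x \in C)%:R)).
  - congr (nat_of_bool _)%:R; apply/idP/idP; rewrite inE.
      by move/in_cluster_in => [].
    by move=> xu; apply/in_cluster_in.
  - exact: fset_uniq.
  - by rewrite fpowersetE; apply/fsubsetP => z /in_cluster_in[].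
by rewrite (expect_conn G_sym G_lf x u w0 p01 us Ss) mulrA [_ * p]mulrC.
Qed.

Definition susceptibility p L u : R := \sum_(v <- L) conn_prob G p L u v.

Lemma susceptibility_step p L S u : 0 <= p <= 1 -> u \in S ->
  susceptibility p L u <= #|` S|%:R + \sum_(x <- S)
    \sum_(y <- nbrs G x | y \notin S) p * conn_prob G p S x u * susceptibility p L y.
Proof.
move=> p01 uS; rewrite /susceptibility (bigID (fun v => v \in S))/=; apply: lerD.
  apply: (@le_trans _ _ (\sum_(v <- L | v \in S) 1)).
    by apply: ler_sum => v _; exact: conn_prob_le1.
  rewrite (eq_bigr (fun=> 1%:R))// -natr_sum ler_nat sum1_count -size_filter.
  apply: uniq_leq_size; first by rewrite filter_uniq// fset_uniq.
  by move=> z; rewrite mem_filter => /andP[].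
apply: le_trans (ler_sum _ (fun v vS => @simon_lieb p L S u v p01 uS vS)) _.
rewrite exchange_big /=; apply: ler_sum => x _.
rewrite exchange_big /=; apply: ler_sum => y _.
rewrite -mulr_sumr ler_wpM2l//.
  by rewrite mulr_ge0 ?conn_prob_ge0//; case/andP: p01.
rewrite [leRHS](bigID (fun v => v \in S))/= lerDr sumr_ge0// => v _.
exact: conn_prob_ge0.
Qed.

(** The supremum [M] of the susceptibilities in [L] is finite since [L] is, and
satisfies [M <= K + a * M]. *)
Lemma susceptibility_bounded p K a : 0 <= p <= 1 -> a < 1 ->
  (forall u, exists S : {fset V}, [/\ u \in S, #|` S|%:R <= K &
     p * boundary_sum p S u <= a]) ->
  forall L u, susceptibility p L u <= K / (1 - a).
Proof.
move=> p01 a1 hS L; have [p0 p1] := andP p01.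
pose M := sup (range (susceptibility p L)).
have chi0 u : 0 <= susceptibility p L u by apply: sumr_ge0 => v _; exact: conn_prob_ge0.
have chi_le u : susceptibility p L u <= M.
  apply: ub_le_sup; last by exists u.
  exists #|` L|%:R => _ [y _ <-]; rewrite -sum1_size natr_sum.
  by apply: ler_sum => v _; exact: conn_prob_le1.
have step u : susceptibility p L u <= K + a * M.
  have [S [uS SK Sa]] := hS u.
  apply: le_trans (susceptibility_step _ p01 uS) _; apply: lerD => //.
  apply: (@le_trans _ _ (p * boundary_sum p S u * M)); last first.
    by rewrite ler_wpM2r//; exact: le_trans (chi0 u) (chi_le u).
  rewrite /boundary_sum mulr_sumr mulr_suml; apply: ler_sum => x _.
  rewrite mulr_sumr mulr_suml; apply: ler_sum => y _.
  by rewrite ler_wpM2l// mulr_ge0// conn_prob_ge0.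
move=> u; have MK : M <= K + a * M.
  by apply: ge_sup; [exists (susceptibility p L u), u|move=> _ [y _ <-]].
apply: (le_trans (chi_le u)); rewrite ler_pdivlMr ?subr_gt0//.
by rewrite mulrBr mulr1 lerBlDr [M * a]mulrC.
Qed.

End simon_lieb.

(** * A differential inequality for exit probabilities *)

Section sharpness.
Variables (R : realType) (V : choiceType) (G : rel V).
Hypothesis G_sym : symmetric G.
Hypothesis G_lf : locally_finite G.
Local Notation E := (edges G).
Implicit Types (x y z u v o : V) (A S L C : {fset V}) (w : E -> bool) (p : R).

Definition exits L u : set (E -> bool) :=
  [set w | exists2 z, z \notin L & joined (leaving L (retained w)) u z].

Lemma exits_out L u w : u \notin L -> exits L u w.
Proof. by move=> uL; exists u => //; exact: joinedxx. Qed.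

Lemma exits_cons L a b w : retained w a b -> exits L b w -> exits L a w.
Proof.
move=> ab bL; have [aL|/exits_out//] := boolP (a \in L).
have [z zL bz] := bL; exists z => //; apply: joined_cons bz.
by rewrite /leaving aL.
Qed.

(** Induction on an exiting path, backwards from its endpoint outside [L]. *)
Lemma exits_ind L w (Q : V -> Prop) : (forall z, z \notin L -> Q z) ->
  (forall a b, a \in L -> retained w a b -> exits L b w -> Q b -> Q a) ->
  forall u, exits L u w -> Q u.
Proof.
move=> Q0 QS u [z zL]; move: u; apply: joined_ind; first exact: Q0.
by move=> a b /andP[aL ab] bz; apply: QS => //; exists z.
Qed.

Lemma exits_mono L u w w' : (forall e, w e -> w' e) -> exits L u w -> exits L u w'.
Proof.
move=> ww'; move: u; apply: exits_ind => [z|a b _ ab _]; first exact: exits_out.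
by apply: exits_cons; exact: retained_mono ab.
Qed.

Lemma exits_depends L u : depends_on (edges_at G L) (exits L u).
Proof.
move=> w w' ww'; move: u; apply: exits_ind => [z|a b aL ab _]; first exact: exits_out.
apply: exits_cons; apply: retained_agree ab => e eab; apply: ww'.
by apply: (@mem_edges_at _ _ G_sym G_lf _ _ a) => //; rewrite eab; left.
Qed.

Lemma conn_exits L S u v w : conn S u v w -> exits L v w -> exits L u w.
Proof.
move=> uv vL; move: u uv; apply: joined_ind => // a b /and3P[_ _ ab] _.
exact: exits_cons.
Qed.

Definition enclosed L w : {fset V} := [fset x in L | ~~ `[< exits L x w >]].

Lemma in_enclosed L w x : x \in enclosed L w <-> ~ exits L x w.
Proof.
rewrite !inE /=; split=> [/andP[_ /asboolPn]//|h]; apply/andP; split.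
  by apply/negPn/negP => /(@exits_out L x w)/h.
exact/asboolPn.
Qed.

Lemma notin_enclosed L w x : x \notin enclosed L w <-> exits L x w.
Proof.
split=> [/negP h|h]; first by apply: contrapT => /in_enclosed.
by apply/negP => /in_enclosed.
Qed.

(** The enclosed set can be found by exploring from outside [L]: a path to the outside
never enters it, and the edges inside it are not revealed. *)
Lemma enclosed_supported L S :
  supported (~` inside S) (fun w => (enclosed L w == S)%:R : R).
Proof.
suff H w w' : (forall e : E, (~` inside S) e -> w e = w' e) ->
    enclosed L w = S -> enclosed L w' = S.
  move=> w w' ww'; congr (nat_of_bool _)%:R.
  by apply/eqP/eqP; apply: H => // e /ww'.
move=> ww' LS.
have out a b (e : E) : a \notin S \/ b \notin S -> val e = [set a; b]%classic ->
    w e = w' e.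
  move=> ab eab; apply: ww' => h.
  by case: ab => /negP; apply; apply: h; rewrite /= eab; [left|right].
suff : forall x, exits L x w' <-> exits L x w.
  by move=> h; rewrite -LS; apply/fsetP => x; apply/idP/idP => /in_enclosed hx;
    apply/in_enclosed => /h.
move=> x; split; move: x; apply: exits_ind => [z|a b aL ab bL].
- exact: exits_out.
- move=> bL'; apply: exits_cons (bL'); apply: retained_agree ab => e eab.
  rewrite (out a b)//; right; rewrite -LS; exact/notin_enclosed.
- exact: exits_out.
move=> bL'; apply: exits_cons bL'; apply: retained_agree (ab) => e eab.
rewrite (out a b)//; left; rewrite -LS; apply/notin_enclosed.
exact: exits_cons ab bL.
Qed.

Definition exit_prob p L u : R :=
  expect p (edges_at G L) (ind R (exits L u)) (fun=> false).

(** An edge from [x] in the enclosed set to [y] outside of it is closed, since [y]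
is connected to the outside of [L] and [x] is not; opening it connects [o] to the
outside. *)
Lemma pivotal_influence L o S (e : E) w : S = enclosed L w -> o \in S ->
  (exists x y, [/\ val e = [set x; y]%classic, x \in S, y \notin S & conn S x o w]) ->
  influence e (ind R (exits L o)) w = 1.
Proof.
move=> SE oS [x [y [exy xS yS xo]]].
have yL : exits L y w by apply/notin_enclosed; rewrite -SE.
have we : w e = false.
  apply/negbTE/negP => we; move: xS; rewrite SE => /in_enclosed; apply.
  by apply: exits_cons yL; rewrite (retainedE w exy).
rewrite /influence -we upd_id indT ?indF ?subr0//.
  by apply/in_enclosed; rewrite -SE.
have le_w : forall i, w i -> upd w e true i by move=> i wi; rewrite /upd; case: eqP.
apply: (@conn_exits L S o x).
  by apply: conn_sym; apply: conn_mono xo.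
apply: exits_cons (exits_mono le_w yL).
by rewrite (retainedE _ exy) /upd eqxx.
Qed.

Lemma sum_count_pairs S (Q : pred V) :
  \sum_(x <- S | Q x) \sum_(y <- nbrs G x | y \notin S) 1 =
  (size [seq (x, y) | x <- [seq x <- S | Q x],
                      y <- [seq y <- nbrs G x | y \notin S]])%:R :> R.
Proof.
rewrite size_allpairs_dep sumnE big_map big_filter natr_sum.
by apply: eq_bigr => x _; rewrite size_filter -sum1_count natr_sum.
Qed.

Lemma influence_ge0 L o (e : E) w : 0 <= influence e (ind R (exits L o)) w.
Proof.
rewrite subr_ge0; apply: increasing_upd; apply: increasing_ind => w1 w2.
exact: exits_mono.
Qed.

(** The influences of the edges on the boundary of the enclosed set [c] are counted
through the ordered pairs [(x, y)] with [x] in [c] and [y] outside [c]; the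
orientation makes the map from pairs to edges injective. *)
Lemma sum_influence_pointwise L o w :
  \sum_(S <- fpowerset L) (enclosed L w == S)%:R * ((o \in S)%:R *
    \sum_(x <- S) \sum_(y <- nbrs G x | y \notin S) ind R (conn S x o) w) <=
  \sum_(e <- edges_at G L) influence e (ind R (exits L o)) w.
Proof.
set c := enclosed L w.
have cL : {subset c <= L} by move=> x; rewrite !inE => /andP[].
rewrite (sum_delta (fun S => (o \in S)%:R *
    \sum_(x <- S) \sum_(y <- nbrs G x | y \notin S) ind R (conn S x o) w)) ?fset_uniq//;
  last by rewrite fpowersetE; apply/fsubsetP.
have [oc|oc] := boolP (o \in c); last first.
  by rewrite mul0r sumr_ge0// => e _; exact: influence_ge0.
rewrite mul1r.
pose Q x := `[< conn c x o w >].
rewrite (_ : \sum_(x <- c) _ =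
  \sum_(x <- c | Q x) \sum_(y <- nbrs G x | y \notin c) 1); last first.
  rewrite [RHS]big_mkcond/=; apply: eq_bigr => x _; rewrite /Q.
  case: asboolP => [h|h]; first by apply: eq_bigr => y _; rewrite indT.
  by rewrite big1// => y _; rewrite indF.
rewrite sum_count_pairs; set pairs := [seq _ | _ <- _, _ <- _].
pose good (e : E) := `[< exists x y, [/\ val e = [set x; y]%classic,
  x \in c, y \notin c & conn c x o w] >].
apply: (@le_trans _ _ (\sum_(e <- edges_at G L | good e) 1)); last first.
  rewrite [leLHS]big_mkcond; apply: ler_sum => e _.
  case: ifP => [/asboolP he|_]; last exact: influence_ge0.
  by rewrite (@pivotal_influence L o c).
rewrite (eq_bigr (fun=> 1%:R))// -natr_sum sum1_count -size_filter ler_nat.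
have pairsP (z : V * V) : z \in pairs ->
    [/\ z.1 \in c, z.2 \notin c, G z.1 z.2 & conn c z.1 o w].
  case/allpairsPdep => x [y []]; rewrite !mem_filter => /andP[/asboolP xo xc] /andP[yc].
  by rewrite in_nbrs// => xy ->.
case: (pairs =P [::]) => [->//|]; case: {2}pairs (erefl pairs) => // z0 pairs' pE _.
have z0p : z0 \in pairs by rewrite pE mem_head.
have [_ _ /edge_of[e0 _] _] := pairsP z0 z0p.
(* the default value [e0] is never used on [pairs] *)
pose eps (z : V * V) : E := insubd e0 [set z.1; z.2]%classic.
have epsE (z : V * V) : z \in pairs -> val (eps z) = [set z.1; z.2]%classic.
  move=> /pairsP[_ _ zz _]; rewrite val_insubd mem_set//.
  by exists z.1, z.2.
rewrite -(size_map eps); apply: uniq_leq_size.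
  rewrite map_inj_in_uniq.
    by apply: allpairs_uniq_dep => [|x _|[x y] [x' y'] _ _ /= [-> ->]]//;
      rewrite filter_uniq ?fset_uniq.
  move=> z z' hz hz' /(congr1 val); rewrite !epsE//.
  move: hz hz' => /pairsP[z1 z2 _ _] /pairsP[z1' z2' _ _] /set2_inj[[]|[h1 h2]].
    by case: z z' {z1 z2 z1' z2'} => ? ? [? ?] /= -> ->.
  by move: z2'; rewrite -h1 z1.
move=> _ /mapP[z zp ->]; have [z1 z2 zz zo] := pairsP z zp.
rewrite mem_filter; apply/andP; split.
  by apply/asboolP; exists z.1, z.2; split => //; exact: epsE.
apply: (@mem_edges_at _ _ G_sym G_lf _ _ z.1); first exact: cL.
by rewrite epsE//; left.
Qed.

(** With probability [1 - exit_prob p L o] the enclosed set contains [o].  Given that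
it equals such an [S], the configuration inside [S] is still a fresh percolation, so
the expected number of pivotal edges is at least [boundary_sum G p S o]. *)
Lemma differential_inequality p L o : 0 <= p <= 1 ->
  (forall S : {fset V}, o \in S -> 1 <= boundary_sum G p S o) ->
  1 - exit_prob p L o <=
  \sum_(e <- edges_at G L)
    expect p (edges_at G L) (influence e (ind R (exits L o))) (fun=> false).
Proof.
move=> p01 bS; set s := edges_at G L; set w0 : E -> bool := fun=> false.
have us : uniq s by exact: edges_at_uniq.
rewrite -expect_sum.
apply: (le_trans _ (le_expect s w0 p01 (sum_influence_pointwise L o))).
rewrite expect_sum.
apply: (@le_trans _ _ (\sum_(S <- fpowerset L)
    expect p s (fun w => (enclosed L w == S)%:R * (o \in S)%:R) w0)).
  rewrite -expect_sum /exit_prob -/s -[X in X - _](expect_cst p s 1 w0).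
  rewrite -mulN1r -expectZ -expectD; apply: le_expect => // w.
  rewrite (sum_delta (fun S => (o \in S)%:R)) ?fset_uniq//; last first.
    by rewrite fpowersetE; apply/fsubsetP => x; rewrite !inE => /andP[].
  have [ow|ow] := pselect (exits L o w).
    by rewrite indT// mulN1r subrr.
  by rewrite indF// mulr0 addr0; have /in_enclosed -> := ow.
rewrite big_seq [leRHS]big_seq; apply: ler_sum => S; rewrite fpowersetE => /fsubsetP SL.
have [oS|oS] := boolP (o \in S); last first.
  by apply: le_expect => // w; rewrite mul0r.
rewrite (@eq_expect _ _ p s (fun w => (enclosed L w == S)%:R * true%:R)
  (fun w => (enclosed L w == S)%:R) w0); last by move=> w; rewrite mulr1.
rewrite (@expect_indep _ _ _ p s (fun w => (enclosed L w == S)%:R) _ w0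
  (@enclosed_supported L S)); last first.
  move=> w w' ww'; congr (_ * _); apply: eq_bigr => x _; apply: eq_bigr => y _.
  by apply: conn_supported => e eS; apply: ww' => /(_ eS).
rewrite ler_peMr//; first by apply: expect_ge0 => // w; exact: ler0n.
rewrite (@eq_expect _ _ p s _ (fun w => \sum_(x <- S)
  \sum_(y <- nbrs G x | y \notin S) ind R (conn S x o) w) w0); last first.
  by move=> w; rewrite mul1r.
apply: le_trans (bS S oS) _.
rewrite expect_sum /boundary_sum; apply: ler_sum => x _.
rewrite expect_sum; apply: ler_sum => y _.
by rewrite (expect_conn G_sym G_lf) //; exact: sub_edges_at.
Qed.

Lemma le_exit_prob_p p q L o : 0 <= p -> p <= q -> q <= 1 ->
  exit_prob p L o <= exit_prob q L o.
Proof.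
move=> p0 pq q1; apply: le_expect_p => //; apply: increasing_ind => w w'.
exact: exits_mono.
Qed.

(** With [f t] for the exit probability, the mean value theorem gives
[f q - f p >= (q - p) * (1 - f q)], because [1 - f] is nonincreasing. *)
Lemma exit_prob_lower p q L o : 0 <= p -> p < q -> q <= 1 ->
  (forall S : {fset V}, o \in S -> 1 <= boundary_sum G p S o) ->
  (q - p) / (1 + (q - p)) <= exit_prob q L o.
Proof.
move=> p0 pq q1 bS.
have uL := edges_at_uniq G L.
have bS' t : p <= t <= 1 -> forall S : {fset V}, o \in S -> 1 <= boundary_sum G t S o.
  move=> /andP[pt t1] S oS; apply: (le_trans (bS S oS)).
  by apply: ler_sum => x _; apply: ler_sum => y _; exact: le_conn_prob_p.
have der t := Russo_formula (ind R (exits L o)) (fun=> false) t uL.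
have dv t : derivable (fun t => exit_prob t L o) t 1 by case: (der t).
have [t tpq E1] := @MVT R (fun t => exit_prob t L o)
  (fun t => \sum_(e <- edges_at G L)
     expect t (edges_at G L) (influence e (ind R (exits L o))) (fun=> false))
  p q pq (fun t _ => der t)
  (derivable_within_continuous (fun t _ => dv t)).
move: tpq; rewrite in_itv /= => /andP[pt tq].
have t01 : 0 <= t <= 1 by rewrite (ltW (le_lt_trans p0 pt)) (ltW (lt_le_trans tq q1)).
have pt1 : p <= t <= 1 by rewrite (ltW pt); case/andP: t01.
have D := differential_inequality L t01 (bS' t pt1).
have tq' : exit_prob t L o <= exit_prob q L o.
  by apply: le_exit_prob_p; [case/andP: t01|exact: ltW|].
have p0' : 0 <= exit_prob p L o.
  apply: expect_ge0 => [|w]; last exact: ind_ge0.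
  by rewrite p0 (le_trans _ q1)// ltW.
have qp : 0 < q - p by rewrite subr_gt0.
rewrite ler_pdivrMr; last by rewrite addr_gt0.
move: E1; move: (\sum_(_ <- _) _) D => D0 D E1.
have : (1 - exit_prob q L o) * (q - p) <= D0 * (q - p).
  by rewrite ler_wpM2r ?(ltW qp)//; apply: le_trans D; rewrite lerB.
(* with [d = q - p]: [d * (1 - f q) <= f q - f p <= f q] *)
by rewrite -E1 => h; nra.
Qed.

End sharpness.

(** * Percolation on the infinite graph *)

Section infinite_volume.
Variables (R : realType) (V : choiceType) (G : rel V).
Hypothesis G_sym : symmetric G.
Hypothesis G_conn : graph_connected G.
Hypothesis G_lf : locally_finite G.
Local Notation E := (edges G).
Implicit Types (x y z u v o : V) (A S L : {fset V}) (w : E -> bool) (p C : R).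

Definition tauR p x y : R := fine (tau G p x y).

Lemma measurable_conn A x y : measurable (conn A x y : set (configuration E)).
Proof.
have h := @bernoulli_productP R E 0; apply: (measurable_depends (h _)).
  by rewrite lexx ler01.
by apply: (conn_depends G_sym G_lf (s := edges_at G A)).
Qed.

Lemma percolation_conn p A x y : 0 <= p <= 1 ->
  percolation G p (conn A x y) = (conn_prob G p A x y)%:E.
Proof.
move=> p01; apply: (measure_depends (bernoulli_productP p01)).
  exact: edges_at_uniq.
exact: conn_depends.
Qed.

Lemma conn_bigcup o x y :
  [set w : E -> bool | joined (retained w) x y] = \bigcup_n conn (fball G o n) x y.
Proof.
apply/seteqP; split=> w /=.
  by move=> /(joined_fball G_conn G_lf o)[n h]; exists n.
by move=> [n _]; apply: sub_joined => a b /and3P[].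
Qed.

Lemma measurable_joined x y :
  measurable ([set w | joined (retained w) x y] : set (configuration E)).
Proof.
by rewrite (conn_bigcup x); apply: bigcup_measurable => n _; exact: measurable_conn.
Qed.

Lemma tauE p x y : tau G p x y = (tauR p x y)%:E.
Proof.
by rewrite /tauR fineK//; apply: fin_num_measure; exact: measurable_joined.
Qed.

Lemma tauR_le1 p x y : tauR p x y <= 1.
Proof. by rewrite -lee_fin -tauE; apply: probability_le1; exact: measurable_joined. Qed.

Lemma conn_prob_cvg p o x y : 0 <= p <= 1 ->
  conn_prob G p (fball G o n) x y @[n --> \oo] --> tauR p x y.
Proof.
move=> p01.
have := @nondecreasing_cvg_mu _ _ _ (percolation G p) (fun n => conn (fball G o n) x y).
rewrite -conn_bigcup => /(_ (fun n => measurable_conn _ x y) (measurable_joined x y)) h.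
have {}h : (percolation G p \o (fun n => conn (fball G o n) x y)) n @[n --> \oo] -->
    (tauR p x y)%:E.
  rewrite -tauE; apply: h => m n mn; rewrite subsetEset => w.
  by apply: sub_conn; exact: sub_fball.
rewrite (_ : (fun n => conn_prob G p (fball G o n) x y) =
    fine \o (percolation G p \o (fun n => conn (fball G o n) x y))).
  exact: fine_cvg.
by apply/funext => n /=; rewrite percolation_conn.
Qed.

Lemma conn_prob_le_tauR p A x y : 0 <= p <= 1 -> conn_prob G p A x y <= tauR p x y.
Proof.
move=> p01; rewrite -lee_fin -tauE -percolation_conn//.
apply: le_measure; rewrite ?inE; [exact: measurable_conn|exact: measurable_joined|].
by move=> w; apply: sub_joined => a b /and3P[].
Qed.

Lemma tauR_le p x y c o : 0 <= p <= 1 ->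
  (forall n, conn_prob G p (fball G o n) x y <= c) -> tauR p x y <= c.
Proof.
move=> p01 h; have cv := @conn_prob_cvg p o x y p01.
rewrite -(cvg_lim (@Rhausdorff R) cv).
apply: limr_le; first by apply/cvg_ex; eexists; exact: cv.
by near=> n.
Unshelve. all: by end_near. Qed.

Lemma tauR_mul p x y z : 0 <= p <= 1 -> tauR p x y * tauR p y z <= tauR p x z.
Proof.
move=> p01.
have cv : conn_prob G p (fball G x n) x y * conn_prob G p (fball G x n) y z
    @[n --> \oo] --> tauR p x y * tauR p y z.
  by apply: cvgM; exact: conn_prob_cvg.
rewrite -(cvg_lim (@Rhausdorff R) cv).
apply: limr_le; first by apply/cvg_ex; eexists; exact: cv.
near=> n; apply: le_trans (conn_prob_le_tauR (fball G x n) x z p01).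
exact: conn_prob_mul.
Unshelve. all: by end_near. Qed.

Lemma tauR_xx p x : 0 <= p <= 1 -> tauR p x x = 1.
Proof.
move=> p01; apply/le_anti; rewrite tauR_le1/=.
apply: le_trans (conn_prob_le_tauR (fset0 : {fset V}) x x p01).
rewrite /conn_prob -[X in X <= _](expect_cst p (edges_at G fset0) 1 (fun=> false)).
by apply: le_expect => // w; rewrite indT//; exact: joinedxx.
Qed.

Lemma le_tauR_p p q x y : 0 <= p -> p <= q -> q <= 1 -> tauR p x y <= tauR q x y.
Proof.
move=> p0 pq q1; apply: (@tauR_le _ _ _ _ x) => [|n].
  by rewrite p0 (le_trans pq).
apply: le_trans (conn_prob_le_tauR (fball G x n) x y _); first exact: le_conn_prob_p.
by rewrite q1 (le_trans p0).
Qed.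

Lemma sum_tauR_le p x (F : {fset V}) C : 0 <= p <= 1 ->
  (forall L, susceptibility G p L x <= C) -> \sum_(y <- F) tauR p x y <= C.
Proof.
move=> p01 hC.
have cv : \sum_(y <- F) conn_prob G p (fball G x n) x y @[n --> \oo] -->
    \sum_(y <- F) tauR p x y.
  apply: cvg_big; first exact: add_continuous.
  by move=> y _; exact: conn_prob_cvg.
rewrite -(cvg_lim (@Rhausdorff R) cv).
apply: limr_le; first by apply/cvg_ex; eexists; exact: cv.
near=> n; apply: le_trans (hC (F `|` fball G x n)).
rewrite /susceptibility.
apply: (@le_trans _ _ (\sum_(y <- F) conn_prob G p (F `|` fball G x n) x y)).
  by apply: ler_sum => y _; apply: le_conn_prob_A => // z; rewrite in_fsetU orbC => ->.
rewrite [leRHS](bigID (fun y => y \in F))/=.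
rewrite -[X in _ <= X + _]big_filter [X in _ <= X + _](perm_big F) /=.
  by rewrite lerDl sumr_ge0// => y _; exact: conn_prob_ge0.
apply: uniq_perm; rewrite ?filter_uniq ?fset_uniq// => z.
by rewrite mem_filter in_fsetU; case: (z \in F).
Unshelve. all: by end_near. Qed.

Lemma tauR_expr p n k : 0 <= p <= 1 -> 0 <= k ->
  (forall x y, (graph_dist G x y <= n)%N -> k <= tauR p x y) ->
  forall m x y, (graph_dist G x y <= m * n)%N -> k ^+ m <= tauR p x y.
Proof.
move=> p01 k0 hk; elim=> [|m IH] x y.
  rewrite mul0n leqn0 expr0 => /eqP d0.
  have /(graph_distP G_conn)[m] : (graph_dist G x y <= 0)%N by rewrite d0.
  by rewrite leqn0 => /eqP -> [s []]; case: s => //= _ <- _; rewrite tauR_xx.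
rewrite mulSn => /(graph_dist_split G_conn)[z [xz zy]].
apply: le_trans (tauR_mul x z y p01).
by rewrite exprS ler_pM ?exprn_ge0//; [exact: hk|exact: IH].
Qed.

(** Sum the lower bound [k ^+ m] of the connection probabilities over the ball. *)
Lemma fball_growth_bound p n k C x : 0 <= p <= 1 -> 0 <= k ->
  (forall x y, (graph_dist G x y <= n)%N -> k <= tauR p x y) ->
  (forall L, susceptibility G p L x <= C) ->
  forall m, #|` fball G x (m * n)|%:R * k ^+ m <= C.
Proof.
move=> p01 k0 hk hC m; apply: le_trans (sum_tauR_le (fball G x (m * n)) p01 hC).
rewrite -sum1_size natr_sum mulr_suml big_seq [leRHS]big_seq; apply: ler_sum => y.
by rewrite in_fball// mul1r; exact: tauR_expr.
Qed.

Lemma measurable_exits L x : measurable (exits L x : set (configuration E)).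
Proof.
have h := @bernoulli_productP R E 0; apply: (measurable_depends (h _)).
  by rewrite lexx ler01.
exact: exits_depends.
Qed.

Lemma percolation_exits p L x : 0 <= p <= 1 ->
  percolation G p (exits L x) = (exit_prob G p L x)%:E.
Proof.
move=> p01; apply: (measure_depends (bernoulli_productP p01)).
  exact: edges_at_uniq.
exact: exits_depends.
Qed.

Lemma exits_sub L L' x w : {subset L <= L'} -> exits L' x w -> exits L x w.
Proof.
move=> LL'; move: x; apply: exits_ind => [z zL|a b _ ab _].
  by apply: exits_out; apply: contra zL; exact: LL'.
exact: exits_cons.
Qed.

(** A finite cluster would be contained in some ball. *)
Lemma infinite_cluster x w : (forall n, exits (fball G x n) x w) ->
  ~ no_infinite_cluster w.
Proof.
move=> hx /(_ x) /finite_fsetP[F FE].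
have [z zB] := hx (\max_(y <- F) graph_dist G x y)%N.
move=> xz; move/negP: zB; apply; rewrite in_fball//.
apply: leq_bigmax_seq => //.
have : cluster_at w x z by apply: sub_joined xz => a b /andP[].
by rewrite FE.
Qed.

Lemma no_infinite_exit_prob p x c : 0 <= p <= 1 ->
  {ae percolation G p, forall w, no_infinite_cluster w} ->
  (forall n, c <= exit_prob G p (fball G x n) x) -> c <= 0.
Proof.
move=> p01 [N [mN N0 sN]] hc; rewrite -lee_fin.
have mI : measurable (\bigcap_n exits (fball G x n) x : set (configuration E)).
  by apply: bigcap_measurable => // n _; exact: measurable_exits.
have I0 : (percolation G p (\bigcap_n exits (fball G x n) x) <= 0)%E.
  rewrite -N0; apply: le_measure; rewrite ?inE//.
  by move=> w hw; apply: sN => /=; apply: infinite_cluster => n; exact: hw.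
apply: le_trans I0.
have cv := @nonincreasing_cvg_mu _ _ _ (percolation G p)
  (fun n => exits (fball G x n) x).
have {}cv : (percolation G p \o (fun n => exits (fball G x n) x)) n @[n --> \oo] -->
    percolation G p (\bigcap_n exits (fball G x n) x).
  apply: cv => //.
  - by apply: le_lt_trans (probability_le1 _ _) (ltry 1); exact: measurable_exits.
  - by move=> n; exact: measurable_exits.
  - move=> m n mn; rewrite subsetEset => w.
    by apply: exits_sub; exact: sub_fball.
rewrite -(cvg_lim (@ereal_hausdorff R) cv); apply: lime_ge.
  by apply/cvg_ex; eexists; exact: cv.
by near=> n; rewrite /= percolation_exits// lee_fin.
Unshelve. all: by end_near. Qed.

(** For [p] below the critical probability, some [q > p] has no infinite cluster;
if [p * boundary_sum G p S x >= 1] held for all [S], so would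
[boundary_sum G p S x >= 1], and the exit probabilities at [q] would be bounded away
from 0. *)
Lemma subcritical_finite_criterion p x : 0 <= p <= 1 ->
  p = 0 \/ p < critical_probability R G ->
  exists2 S : {fset V}, x \in S & p * boundary_sum G p S x < 1.
Proof.
move=> p01 [->|ppc].
  by exists [fset x]; rewrite ?in_fset1// mul0r ltr01.
have [p0 p1] := andP p01.
apply: contrapT => hS.
have [|q [/andP[q0 q1] aeq] pq] := sup_gt _ ppc.
  apply/set0P/negP => /eqP h0; move: ppc.
  by rewrite /critical_probability h0 sup0 ltNge p0.
have bS (S : {fset V}) : x \in S -> 1 <= boundary_sum G p S x.
  move=> xS; rewrite leNgt; apply/negP => b1; apply: hS; exists S => //.
  apply: le_lt_trans b1; rewrite ler_piMl//.
  by apply: sumr_ge0 => y _; apply: sumr_ge0 => z _; exact: conn_prob_ge0.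
have q01 : 0 <= q <= 1 by rewrite q0.
have := no_infinite_exit_prob q01 aeq
  (fun n => exit_prob_lower G_sym G_lf (fball G x n) p0 pq q1 bS).
have qp : 0 < q - p by rewrite subr_gt0.
by rewrite leNgt divr_gt0// addr_gt0.
Qed.

End infinite_volume.

(** * From ball sizes to the growth rate *)

Section growth_rate.
Variable R : realType.

Lemma bernoulli_ineq (h : R) m : 0 <= h -> 1 + m%:R * h <= (1 + h) ^+ m.
Proof.
move=> h0; elim: m => [|m IH]; first by rewrite mul0r addr0 expr0.
rewrite exprS; apply: (@le_trans _ _ ((1 + h) * (1 + m%:R * h))); last first.
  by rewrite ler_wpM2l// addr_ge0.
have : 0 <= m%:R * h * h by rewrite !mulr_ge0.
rewrite -natr1; nra.
Qed.

Lemma unbounded_powers (r C : R) N : 1 < r -> exists2 m, (N <= m)%N & C < r ^+ m.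
Proof.
move=> r1; pose h := r - 1; have h0 : 0 < h by rewrite subr_gt0.
pose M := (Num.bound (`|C| / h)).
have hM : `|C| / h < M%:R by apply: archi_boundP; rewrite divr_ge0// ltW.
exists (N + M)%N; first exact: leq_addr.
have -> : r = 1 + h by rewrite /h addrC subrK.
apply: lt_le_trans (bernoulli_ineq _ (ltW h0)).
move: hM; rewrite ltr_pdivrMr// => hM.
apply: (le_lt_trans (ler_norm C)); apply: (lt_trans hM).
rewrite natrD mulrDl; have : 0 <= N%:R * h by rewrite mulr_ge0// ltW.
by lra.
Qed.

(** If the lower limit exceeded the bound, [c (m * n) >= b ^ (m * n)] would hold for
all large [m] and some [b] with [b ^ n * k > 1], so [c (m * n) * k ^ m] would be
unbounded. *)
Lemma limn_einf_root_le (c : nat -> R) (C k : R) n : (0 < n)%N -> 0 < k ->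
  (forall m, 0 <= c m) -> (forall m, c (m * n)%N * k ^+ m <= C) ->
  (limn_einf (fun r : nat => (c r `^ (r%:R^-1))%:E) <= ((k^-1) `^ (n%:R^-1))%:E)%E.
Proof.
move=> n0 k0 c0 cC; rewrite leNgt; apply/negP.
rewrite limn_einf_lim (cvg_lim (@ereal_hausdorff R) (@cvg_einfs_sup _ _)).
move=> /ereal_sup_gt[_ [N _ <-]].
set I := einfs _ N => rootI.
have IN r : (N <= r)%N -> (I <= (c r `^ (r%:R^-1))%:E)%E.
  by move=> Nr; apply: ereal_inf_lbound; exists r.
case: I rootI IN => [b|_ /(_ N (leqnn N))|//]; last by rewrite leye_eq.
rewrite lte_fin => rootb bN.
have root0 : 0 <= (k^-1) `^ (n%:R^-1) := powR_ge0 _ _.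
have b0 : 0 <= b by apply: ltW; exact: le_lt_trans rootb.
have rootn : ((k^-1) `^ (n%:R^-1)) ^+ n = k^-1.
  rewrite -powR_mulrn// -powRrM mulVf ?pnatr_eq0 -?lt0n//.
  by rewrite powRr1// invr_ge0 ltW.
have rho1 : 1 < b ^+ n * k.
  by rewrite -ltr_pdivrMr// mul1r -rootn ltrXn2r// -lt0n.
(* [m >= 1] makes the exponent [m * n] invertible *)
have [m + Cm] := unbounded_powers C (maxn N 1) rho1.
rewrite geq_max => /andP[Nm m0].
move: Cm; apply/negP; rewrite -leNgt; apply: le_trans (cC m).
have mn0 : (0 < m * n)%N by rewrite muln_gt0 m0.
rewrite exprMn -exprM [(n * m)%N]mulnC ler_wpM2r// ?exprn_ge0 ?(ltW k0)//.
have := bN (m * n)%N (leq_trans Nm (leq_pmulr _ n0)).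
rewrite lee_fin => hb.
have : b ^+ (m * n) <= (c (m * n)%N `^ ((m * n)%:R^-1)) ^+ (m * n).
  by rewrite lerXn2r// ?nnegrE// powR_ge0.
rewrite -[leRHS]powR_mulrn ?powR_ge0// -powRrM mulVf ?pnatr_eq0 -?lt0n//.
by rewrite powRr1.
Qed.

End growth_rate.

(** * Uniformity over the orbits and left continuity *)

Section quasi_transitive.
Variables (R : realType) (V : choiceType) (G : rel V).
Hypothesis G_sym : symmetric G.
Hypothesis G_conn : graph_connected G.
Hypothesis G_lf : locally_finite G.
Hypothesis G_qt : quasi_transitive G.
Local Notation E := (edges G).
Local Notation tauR := (@tauR R V G).
Implicit Types (x y z u v o : V) (A S L : {fset V}) (w : E -> bool) (p q e C : R).

Lemma orbit_representatives (x0 : V) : exists reps : seq V, forall x,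
  exists r f g, [/\ r \in reps, cancel f g, cancel g f,
    {mono f : x y / G x y} & f r = x].
Proof.
have /finite_fsetP[F FE] := G_qt.
exists [seq xget x0 [set r | aut_orbit G r = B]%classic | B <- F] => x.
have xF : aut_orbit G x \in F.
  have : range (aut_orbit G) (aut_orbit G x) by exists x.
  by rewrite FE.
pose r := xget x0 [set r | aut_orbit G r = aut_orbit G x]%classic.
have rx : aut_orbit G r = aut_orbit G x.
  have /(xgetPex x0) // : exists r, [set r | aut_orbit G r = aut_orbit G x]%classic r.
  by exists x.
have : aut_orbit G r x.
  by rewrite rx; exists id => //; split=> //; exists id.
move=> [f [[g fg gf] f_mono] frx]; exists r, f, g; split=> //.
by apply/mapP; exists (aut_orbit G x).
Qed.

Section image.
Variables (f g : V -> V).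
Hypothesis fg : cancel f g.
Hypothesis gf : cancel g f.
Hypothesis f_mono : {mono f : x y / G x y}.

Lemma boundary_sum_image p S u : 0 <= p <= 1 ->
  boundary_sum G p [fset f z | z in S] (f u) = boundary_sum G p S u.
Proof.
move=> p01; rewrite /boundary_sum big_imfset /=; last first.
  by move=> ? ? _ _; exact: can_inj fg _ _.
apply: eq_bigr => x _; rewrite big_mkcond [RHS]big_mkcond /=.
have -> : nbrs G (f x) = [fset f y | y in nbrs G x].
  apply/fsetP => y; rewrite in_nbrs//; apply/idP/imfsetP => /= [fxy|[y' xy' ->]].
    by exists (g y); rewrite ?gf// in_nbrs// -f_mono gf.
  by rewrite f_mono -in_nbrs.
rewrite big_imfset /=; last by move=> ? ? _ _; exact: can_inj fg _ _.
apply: eq_bigr => y _; rewrite (conn_prob_image G_sym G_lf fg f_mono)// mem_imfset//.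
exact: can_inj fg.
Qed.

Lemma tauR_image_le p x y : 0 <= p <= 1 -> tauR p x y <= tauR p (f x) (f y).
Proof.
move=> p01; apply: (@tauR_le _ _ _ G_sym G_conn G_lf _ _ _ _ x) => // n.
rewrite -(conn_prob_image G_sym G_lf fg f_mono)//.
exact: conn_prob_le_tauR.
Qed.

Lemma graph_dist_image_le x y n : (graph_dist G x y <= n)%N ->
  (graph_dist G (f x) (f y) <= n)%N.
Proof.
move=> /(graph_distP G_conn)[m mn [s [ps ls sz]]]; apply/(graph_distP G_conn).
exists m => //; exists (map f s); split; last by rewrite size_map.
  by rewrite path_map; apply: sub_path ps => a b /=; rewrite f_mono.
by rewrite last_map ls.
Qed.

End image.

(** The sets chosen for finitely many orbit representatives are transported by
automorphisms to all other vertices. *)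
Lemma susceptibility_finite (x0 : V) p : 0 <= p <= 1 ->
  p = 0 \/ p < critical_probability R G ->
  exists C, forall L u, susceptibility G p L u <= C.
Proof.
move=> p01 ppc; have [reps hreps] := orbit_representatives x0.
have /choice[S hS] : forall x, exists S : {fset V},
    x \in S /\ p * boundary_sum G p S x < 1.
  move=> x; have [S xS b1] := subcritical_finite_criterion G_sym G_conn G_lf x p01 ppc.
  by exists S.
pose a := \big[Num.max/0]_(r <- reps) (p * boundary_sum G p (S r) r).
exists ((\sum_(r <- reps) #|` S r|%:R) / (1 - a)) => L u.
apply: susceptibility_bounded => // [|{}u].
  rewrite /a; elim/big_ind : _ => [|b c b1 c1|r _]; first exact: ltr01.
    by rewrite gt_max b1.
  by have [] := hS r.
have [r [f [g [rr fg gf f_mono <-]]]] := hreps u.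
exists [fset f z | z in S r]; split.
- by rewrite mem_imfset; [have [] := hS r|exact: can_inj fg].
- rewrite card_imfset; last exact: can_inj fg.
  exact: (le_sum_term (F := fun r => #|` S r|%:R) (P := xpredT)).
- rewrite (boundary_sum_image fg gf)//.
  exact: (le_bigmax_seq 0 r xpredT (fun r => p * boundary_sum G p (S r) r) rr erefl).
Qed.

(** A connection probability at [q] is nearly attained in a finite ball, where it is
a polynomial in the parameter. *)
Lemma tauR_left_continuous q e x y : 0 < q -> q <= 1 -> 0 < e ->
  exists2 p, 0 <= p < q & tauR q x y - e <= tauR p x y.
Proof.
move=> q0 q1 e0; have q01 : 0 <= q <= 1 by rewrite ltW.
have e20 : 0 < e / 2 by rewrite divr_gt0.
(* half of [e] is lost in the finite ball, half in the parameter *)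
have [n hn] : exists n, tauR q x y - e / 2 < conn_prob G q (fball G x n) x y.
  apply: contrapT => h.
  have : tauR q x y <= tauR q x y - e / 2.
    apply: (@tauR_le _ _ _ G_sym G_conn G_lf _ _ _ _ x) => // n.
    by rewrite leNgt; apply/negP => hn; apply: h; exists n.
  by move=> ?; lra.
set A := fball G x n in hn.
have der : derivable (fun t => conn_prob G t A x y) q 1.
  by case: (Russo_formula (ind R (conn A x y)) (fun=> false) q (edges_at_uniq G A)).
have cont : {for q, continuous (fun t => conn_prob G t A x y)}.
  by apply: differentiable_continuous; exact/derivable1_diffP.
have hq : \forall t \near q^'-,
    [/\ 0 < t, t < q & conn_prob G q A x y - e / 2 < conn_prob G t A x y].
  near=> t; split; near: t.
  - exact: nbhs_left_gt.
  - exact: nbhs_left_lt.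
  - apply: (cvgr_gt (conn_prob G q A x y) (cvg_at_left_filter cont)).
    by rewrite gtrBl.
have [t [t0 tq ht]] := @filter_ex _ _ _ _ hq.
exists t; first by rewrite ltW.
apply: le_trans (conn_prob_le_tauR G_sym G_conn G_lf A x y _); last first.
  by rewrite ltW//= (le_trans (ltW tq)).
by move: hn ht; lra.
Unshelve. all: by end_near. Qed.

Lemma tauR_left_continuous_seq q e (l : seq (V * V)) : 0 < q -> q <= 1 -> 0 < e ->
  exists2 p, 0 <= p < q &
    forall z : V * V, z \in l -> tauR q z.1 z.2 - e <= tauR p z.1 z.2.
Proof.
move=> q0 q1 e0; elim: l => [|z l [p /andP[p0 pq] hp]].
  by exists 0; rewrite ?lexx.
have [t /andP[t0 tq] ht] := tauR_left_continuous z.1 z.2 q0 q1 e0.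
have mq : Num.max p t < q by rewrite gt_max pq.
have m1 : Num.max p t <= 1 by rewrite (le_trans (ltW mq)).
exists (Num.max p t); first by rewrite mq le_max p0.
move=> z'; rewrite inE => /orP[/eqP->|/hp{}hp].
  apply: (le_trans ht); apply: le_tauR_p => //.
  by rewrite le_max lexx orbT.
by apply: (le_trans hp); apply: le_tauR_p => //; rewrite le_max lexx.
Qed.

(** Up to automorphisms, there are finitely many pairs at distance at most [n]. *)
Lemma tauR_left_continuous_unif (x0 : V) q e n : 0 < q -> q <= 1 -> 0 < e ->
  exists2 p, 0 <= p < q &
    forall x y, (graph_dist G x y <= n)%N -> tauR q x y - e <= tauR p x y.
Proof.
move=> q0 q1 e0; have [reps hreps] := orbit_representatives x0.
have [p pq hp] := tauR_left_continuous_seq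
  [seq (r, y) | r <- reps, y <- fball G r n] q0 q1 e0.
exists p => // x y xy; have [r [f [g [rr fg gf f_mono frx]]]] := hreps x.
have g_mono : {mono g : x y / G x y} by move=> a b; rewrite -f_mono !gf.
have ry : (r, g y) \in [seq (r, y) | r <- reps, y <- fball G r n].
  apply/allpairsPdep; exists r, (g y); split=> //.
  by rewrite in_fball// -(fg r) frx (graph_dist_image_le g_mono).
have [p0 pq'] := andP pq.
have p01 : 0 <= p <= 1 by rewrite p0 (le_trans (ltW pq')).
have q01 : 0 <= q <= 1 by rewrite ltW.
have := tauR_image_le fg f_mono r (g y) p01; rewrite frx gf => h1.
have := tauR_image_le gf g_mono x y q01; rewrite -frx fg frx => h2.
by apply: le_trans h1; apply: le_trans (hp _ ry); rewrite lerB.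
Qed.

(** The bound of the theorem, at parameters where the susceptibility is finite. *)
Lemma le_inv_growth (x0 : V) p k n : 0 <= p <= 1 ->
  p = 0 \/ p < critical_probability R G -> (0 < n)%N -> 0 <= k ->
  (1 < growth G R x0)%E ->
  (forall x y, (graph_dist G x y <= n)%N -> k <= tauR p x y) ->
  (k%:E <= (growth G R x0 ^+ n)^-1)%E.
Proof.
move=> p01 ppc n0 k0 g1 hk.
have g0 : (0 <= growth G R x0)%E by apply: le_trans (ltW g1).
move: k0; rewrite le_eqVlt => /orP[/eqP <-|k0].
  by rewrite inve_ge0 expe_ge0.
have [C hC] := susceptibility_finite x0 p01 ppc.
have := @limn_einf_root_le R (fun r => #|` fball G x0 r|%:R) C k n n0 k0
  (fun=> ler0n _ _) (fball_growth_bound G_sym G_conn G_lf p01 (ltW k0) hk (hC ^~ x0)).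
rewrite -/(growth G R x0); case: (growth G R x0) g0 g1 => [r|//|//].
rewrite !lee_fin lte_fin => r0 r1 rroot.
rewrite -EFin_expe inver expf_eq0 gt_eqF ?andbF ?(lt_trans ltr01)//.
rewrite lee_fin -[leLHS]invrK lef_pV2 ?posrE ?exprn_gt0 ?invr_gt0//;
  last exact: lt_trans r1.
apply: (@le_trans _ _ (((k^-1) `^ (n%:R^-1)) ^+ n)).
  by rewrite lerXn2r// nnegrE powR_ge0.
rewrite -powR_mulrn ?powR_ge0// -powRrM mulVf ?pnatr_eq0 -?lt0n//.
by rewrite powRr1// invr_ge0 ltW.
Qed.

(** If no parameter were almost surely free of infinite clusters, the supremum would
be that of the empty set, which is 0. *)
Lemma critical_probability_itv : 0 <= critical_probability R G <= 1.
Proof.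
rewrite /critical_probability; set P := mkset _.
have P01 : (P `<=` [set p | 0 <= p <= 1])%classic by move=> p [].
have [->|/set0P[p Pp]] := eqVneq P set0; last first.
  apply/andP; split; last by apply: ge_sup; [exists p|move=> q /P01 /andP[]].
  apply: (@le_trans _ _ p); first by have /andP[] := P01 _ Pp.
  by apply: ub_le_sup => //; exists 1 => q /P01 /andP[].
by rewrite sup0 lexx ler01.
Qed.

End quasi_transitive.

Local Open Scope ereal_scope.

Theorem theorem2 (R : realType) (V : choiceType) (G : rel V)
  (G_sym : symmetric G) (G_irr : irreflexive G)
  (G_conn : graph_connected G) (G_lf : locally_finite G)
  (G_qt : quasi_transitive G)
  (x : V) (G_exp : 1 < growth G R x) (n : nat) (n_gt0 : (1 <= n)%N) :
  kappa G (critical_probability R G) n <= (growth G R x ^+ n)^-1.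
Proof.
set q := critical_probability R G.
have q01 : (0 <= q <= 1)%R := critical_probability_itv R G.
have [q0 q1] := andP q01.
have kappa_lb y z : (graph_dist G y z <= n)%N -> kappa G q n <= (tauR G q y z)%:E.
  by move=> yz; apply: ereal_inf_lbound; exists y, z; rewrite tauE.
have kappa0 : 0 <= kappa G q n.
  by apply: le_ereal_inf_tmp => _ [y [z [_ ->]]]; exact: measure_ge0.
have xx : (graph_dist G x x <= n)%N.
  by apply/(graph_distP G_conn); exists 0%N => //; exists [::].
have : kappa G q n \is a fin_num.
  by rewrite ge0_fin_numE//; apply: le_lt_trans (kappa_lb x x xx) (ltry _).
move=> /fineK kE; move: kappa_lb kappa0; rewrite -kE.
move: (fine _) => k kappa_lb; rewrite lee_fin => k0.
have {}kappa_lb y z : (graph_dist G y z <= n)%N -> (k <= tauR G q y z)%R.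
  by move/kappa_lb.
(* at [q = 0] there is no smaller parameter, but clusters are single points *)
have [q_eq0|q_gt0] := eqVneq q 0%R.
  by apply: (le_inv_growth G_sym G_conn G_lf G_qt q01) => //; left.
have {}q_gt0 : (0 < q)%R by rewrite lt_neqAle eq_sym q_gt0.
have inv0 : 0 <= (growth G R x ^+ n)^-1.
  by rewrite inve_ge0 expe_ge0// (le_trans _ (ltW G_exp)).
(* below [q], all the probabilities bounded below by [k] lose at most [e] *)
apply/lee_addgt0Pr => e e0.
have [p /andP[p0 pq] hp] :=
  tauR_left_continuous_unif G_sym G_conn G_lf G_qt x n q_gt0 q1 e0.
have [ke|ek] := leP k e.
  by apply: (@le_trans _ _ (0 + e%:E)); [rewrite add0e lee_fin|rewrite leeD2r].
rewrite -leeBlDr// -EFinB.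
apply: (@le_inv_growth _ _ _ G_sym G_conn G_lf G_qt x p) => //.
- by rewrite p0 (le_trans (ltW pq)).
- by right.
- by rewrite subr_ge0 ltW.
- by move=> y z yz; apply: le_trans (hp y z yz); rewrite lerB// kappa_lb.
Qed.
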